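(* Let $p$ be a prime, $G$ a finite group, $E$ a normal subgroup of $G$ and $P$ a Sylow $p$-subgroup of $E$. If every cyclic subgroup of $P$ of prime order or of order $4$ (the latter only when $P$ is not quaternion-free) satisfies partial $\Pi$-property in $G$, then $E\leq Z_{p\mathfrak{U}}(G)$.
   Context: All groups are finite. For a positive integer $n$ and a set of primes $\pi$, $n$ is a $\pi$-number if all its prime divisors lie in $\pi$ (so $1$ is a $\pi$-number for every $\pi$, including $\pi=\emptyset$); $\pi(H)$ is the set of prime divisors of $|H|$. Partial $\Pi$-property: a subgroup $H$ of $G$ satisfies partial $\Pi$-property in $G$ if there exists a chief series $1=G_0<G_1<\cdots<G_n=G$ of $G$ such that for every $1\leq i\leq n$, the index $|G/G_{i-1}:N_{G/G_{i-1}}(HG_{i-1}/G_{i-1}\cap G_i/G_{i-1})|$ is a $\pi(HG_{i-1}/G_{i-1}\cap G_i/G_{i-1})$-number. A group is quaternion-free if it has no section isomorphic to the quaternion group of order $8$; thus the condition on cyclic subgroups of order $4$ is imposed only when $p=2$ and $P$ is not quaternion-free. $\mathfrak{U}$ is the class of finite supersolvable groups. A chief factor $L/K$ of $G$ is $\mathfrak{U}$-central in $G$ if $(L/K)\rtimes(G/C_G(L/K))\in\mathfrak{U}$. $Z_{p\mathfrak{U}}(G)$, the $p\mathfrak{U}$-hypercentre of $G$, is the product of all normal subgroups $N$ of $G$ such that every $G$-chief factor below $N$ of order divisible by $p$ is $\mathfrak{U}$-central in $G$. *)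

(* Defs.v *)
From mathcomp Require Import all_boot all_fingroup all_solvable.

Set Implicit Arguments.
Unset Strict Implicit.
Unset Printing Implicit Defensive.

Local Open Scope group_scope.

(* Since 1 = G_0, the list s is [:: G_1; ...; G_n].  For K normal in G,         *)
(* the MathComp quotient H / K is HK/K.                                         *)
Definition partial_Pi (gT : finGroupType) (G H : {group gT}) : Prop :=
  exists s : seq {group gT},
    [/\ (G.-chief).-series 1%G s, last 1%G s = G &
        forall i, (i < size s)%N ->
          let K := nth 1%G (1%G :: s) i in
          let L := nth 1%G s i in
          \pi((H / K) :&: (L / K)).-nat
             #|G / K : 'N_(G / K)((H / K) :&: (L / K))| ].

Definition quaternion_free (gT : finGroupType) (P : {group gT}) : bool :=
  [forall B : {group gT}, forall A : {group gT},
     (B \subset P) && (A <| B) ==> ~~ ((B / A) \isog 'Q_8)].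

(* There are G-normal subgroups 1 = H_0 <= H_1 <= ... <= H_n = G with cyclic    *)
(* successive quotients; connect is the reflexive transitive closure.           *)
Definition supersolvable (gT : finGroupType) (G : {group gT}) : bool :=
  connect (fun H K : {group gT} =>
             [&& H <| G, K <| G, H \subset K & cyclic (K / H)])
          1%G G.

(* Conjugation action of G / C_G(L/K) on L/K: 'J / K is the action of N(K) on   *)
(* the cosets of K, and %% passes to the quotient by C_G(L/K).  Its domain      *)
(* N(K) / C_G(L/K) and its range, the centraliser of C_G(L/K) in the group of   *)
(* all cosets of K, contain G / C_G(L/K) and L/K but may be larger.             *)
Definition factor_act (gT : finGroupType) (G L K : {group gT}) :=
  ('J / K %% ('C_G(L / K | 'Q))%g)%gact.
Arguments factor_act {gT} G L K.

(* (L/K) ><| (G / C_G(L/K)), as a subgroup of the external semidirect product   *)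
(* of the range by the domain of factor_act (see factor_sdprodE).               *)
Definition factor_sdprod (gT : finGroupType) (G L K : {group gT}) :=
  (sdpair1 (factor_act G L K) @* (L / K)
     <*> sdpair2 (factor_act G L K) @* (G / 'C_G(L / K | 'Q)))%G.
Arguments factor_sdprod {gT} G L K.

Section FactorAct.

Variables (gT : finGroupType) (G L K : {group gT}).
Hypotheses (nKG : K <| G) (nLG : L <| G).

Let C := 'C_G(L / K | 'Q).

Fact factor_norm : G \subset 'N(C).
Proof.
rewrite normsI ?normG // (subset_trans _ (astab_norm _ _)) //.
by apply: actsQ; rewrite normal_norm.
Qed.

Fact factor_sub_dom : G \subset qact_dom 'J K.
Proof. by rewrite dom_qactJ normal_norm. Qed.

Fact factor_sub_range : L / K \subset 'C_(| 'Q)(C).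
Proof.
rewrite subsetI; apply/andP; split.
  by apply: quotientS; apply: subsetT.
apply/subsetP=> x Lx; apply/afixP=> a /setIP[_ /setIP[_ Ca]].
exact: astab_act Ca Lx.
Qed.

Lemma factor_actE x g : x \in L / K -> g \in G ->
  factor_act G L K x (coset C g) = x ^ coset K g.
Proof.
move=> Lx Gg; rewrite /factor_act /= modactE.
- by rewrite qactJ (subsetP (normal_norm nKG)).
- exact: (subsetP factor_sub_dom).
- exact: (subsetP factor_norm).
by have /subsetP/(_ x Lx)/setIP[] := factor_sub_range.
Qed.

Lemma factor_sdprodE :
  [/\ sdpair1 (factor_act G L K) @* (L / K)
        ><| sdpair2 (factor_act G L K) @* (G / C) = factor_sdprod G L K,
      L / K \isog sdpair1 (factor_act G L K) @* (L / K) &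
      G / C \isog sdpair2 (factor_act G L K) @* (G / C)].
Proof.
have sGD : G / C \subset qact_dom 'J K / C := quotientS _ factor_sub_dom.
split.
- rewrite sdprodEY //.
    rewrite -actsEsd // ?factor_sub_range //.
    apply/subsetP=> _ /morphimP[a Na Ga ->].
    rewrite !inE /= mem_quotient ?(subsetP factor_sub_dom) //=.
    apply/subsetP=> x Lx; rewrite inE factor_actE //.
    rewrite memJ_norm // (subsetP (quotient_norms K (normal_norm nLG))) //.
    by rewrite mem_quotient.
  apply/trivgP.
  have TI := im_sdpair_TI (factor_act G L K).
  apply: (subset_trans (setISS (morphimS _ factor_sub_range) (morphimS _ sGD))).
  by rewrite TI.
- by apply: sub_isog; rewrite ?injm_sdpair1 ?factor_sub_range.
by apply: sub_isog; rewrite ?injm_sdpair2.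
Qed.

End FactorAct.

Definition U_central (gT : finGroupType) (G L K : {group gT}) : bool :=
  supersolvable (factor_sdprod G L K).

Definition pU_hypercentral (gT : finGroupType) (p : nat) (G N : {group gT}) :
    bool :=
  (N <| G) &&
  [forall K : {group gT}, forall L : {group gT},
     [&& chief_factor G K L, L \subset N & p %| #|L / K|] ==> U_central G L K].

(* Join of subgroups, which is the product for normal subgroups.                *)
Definition pU_hypercentre (gT : finGroupType) (p : nat) (G : {group gT}) :
    {group gT} :=
  (\prod_(N : {group gT} | pU_hypercentral p G N) N)%G.

(* Main.v *)
(* Passing to G / O_p'(E), assume O_p'(E) = 1; it suffices to show that a chief *)
(* factor L / K of G below E has order p when p divides its order.  Call x in P *)
(* special if it generates one of the subgroups considered in the hypothesis.   *)
(* The partial Pi-property of <x> gives N <| G, not containing x, such that the *)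
(* normaliser of <x> N has p-power index; if x is in L and K contains every     *)
(* proper subgroup of L normal in G, then N :&: L <= K and the normaliser of    *)
(* <x> K has p-power index as well.                                             *)
(*   Let Q = O_p(E), let L / K be a chief factor with L <= Q and |L| minimal    *)
(* such that |L / K| <> p, and let D be generated by the p'-elements of C_G(K). *)
(* If D centralises L / K, then G acts on L / K as an abelian group of exponent *)
(* dividing p - 1, hence by scalars.  Otherwise [L, D] = L and [K, D] = 1, and  *)
(* this bounds the exponent of L; there is a special x in L, not in K, such     *)
(* that <x> K is normal in G.  So all chief factors below Q have order p.       *)
(*   Next, C_E(Q) <= Q: in a minimal normal counterexample X all special        *)
(* elements lie in Q, hence are central, so p'-elements of X normalising a      *)
(* p-subgroup centralise it; by Frobenius's fusion argument and transfer, X is  *)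
(* a p'-group or X' < X, and both are impossible.  Finally p'-elements of E'    *)
(* centralise the chief factors below Q, hence Q, so they are trivial: E' <= Q  *)
(* and P = Q.                                                                   *)
(*   Quaternion-freeness enters as follows: a nonabelian group of exponent 4 in *)
(* which squares and involutions are central has a section isomorphic to Q_8.   *)

Require Import Defs.
From mathcomp Require Import all_boot all_fingroup all_solvable.
From mathcomp Require Import ssralg finalg poly matrix mxalgebra mxpoly zmodp.
From mathcomp Require Import finfield mxrepresentation mxabelem.

Set Implicit Arguments.
Unset Strict Implicit.
Unset Printing Implicit Defensive.

Local Open Scope group_scope.

(** * Sections isomorphic to Q_8 *)

(** The key device: if x in L is special and K contains every proper subgroup of L normal in G, the
    normaliser T of <x> K has p-power index, so [T * S = G] for a Sylow p-subgroup S of G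
    ([pnat_index_mul]), and <x> K is normal in G as soon as S normalises it.
    [special_chief_factor_order_p] applies this to chief factors inside p-groups, with x supplied by
    [perfect_action_special]; where no such x is to be had, [chief_factor_order_p] shows instead
    that G acts by scalars.

    If O_p'(E) = 1, then O_p(E) contains its centraliser in E ([cent_pcore_sub], through
    [special_centralised], [Sylow_control_fusion] and [perfect_control_fusion]). [Sylow_sub_pcore]
    deduces P = O_p(E), which carries every chief factor of order divisible by p below P.
    [chief_factor_below_order_p] removes the assumption on O_p'(E), and [prime_U_central] turns
    prime order into U-centrality. *)

Definition quaternion_like (gT : finGroupType) (B : {group gT}) : bool :=
  [&& ~~ abelian B,
      [forall x in B, (x ^+ 4 == 1) && (x ^+ 2 \in 'Z(B))] &
      [forall x in B, (x ^+ 2 == 1) ==> (x \in 'Z(B))]].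

(** Forbidding these subgroups, rather than Q_8 as a section, fits what [perfect_action_special]
    meets and is easily carried along injective morphisms. *)
Definition quaternion_like_free (gT : finGroupType) (P : {group gT}) : bool :=
  [forall B : {group gT}, (B \subset P) ==> ~~ quaternion_like B].

Lemma injm_quaternion_like (gT rT : finGroupType) (D B : {group gT})
    (f : {morphism D >-> rT}) :
  'injm f -> B \subset D -> quaternion_like B -> quaternion_like (f @* B).
Proof.
move=> injf sBD /and3P[nabB /forall_inP expB /forall_inP invB].
apply/and3P; split; first by rewrite injm_abelian.
  apply/forall_inP=> _ /morphimP[x Dx Bx ->].
  have /andP[/eqP x4 Zx2] := expB x Bx.
  rewrite -!morphX // x4 morph1 eqxx -(injm_center injf) //=.
  by rewrite mem_morphim // groupX.
apply/forall_inP=> _ /morphimP[x Dx Bx ->]; apply/implyP.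
rewrite -morphX // => fx2; rewrite -(injm_center injf) // mem_morphim //.
by apply: (implyP (invB x Bx)); rewrite -(morph_injm_eq1 injf) // groupX.
Qed.

Lemma injm_quaternion_like_free (gT rT : finGroupType) (D P : {group gT})
    (f : {morphism D >-> rT}) :
  'injm f -> P \subset D -> quaternion_like_free P ->
  quaternion_like_free (f @* P).
Proof.
move=> injf sPD /forallP freeP; apply/forallP=> B; apply/implyP=> sBfP.
have sBfD : B \subset f @* D := subset_trans sBfP (morphimS f sPD).
apply: contra (implyP (freeP (f @*^-1 B)%G) _) => [qB | ].
  have: quaternion_like (invm injf @* B).
    by apply: injm_quaternion_like; rewrite ?injm_invm.
  by congr quaternion_like; apply: val_inj; rewrite /= morphim_invmE.
by rewrite -(injmK injf sPD) morphpreS.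
Qed.

Lemma quaternion_like_freeS (gT : finGroupType) (P Q : {group gT}) :
  Q \subset P -> quaternion_like_free P -> quaternion_like_free Q.
Proof.
move=> sQP /forallP freeP; apply/forallP=> B; apply/implyP=> sBQ.
exact: implyP (freeP B) (subset_trans sBQ sQP).
Qed.

Lemma quaternion_like_freeJ (gT : finGroupType) (P : {group gT}) x :
  quaternion_like_free P -> quaternion_like_free (P :^ x).
Proof.
move=> freeP; have := injm_quaternion_like_free (injm_conj P x) (subxx P) freeP.
by congr quaternion_like_free; apply: val_inj; rewrite /= morphim_conj setIid.
Qed.


(* For noncommuting x and y, the subgroup A generated by x^2 y^2 and            *)
(* y^2 [x, y] does not contain [x, y], and <<x, y>> / A is Q_8.                 *)
Lemma quaternion_like_section (gT : finGroupType) (P B : {group gT}) :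
  B \subset P -> quaternion_like B -> ~~ quaternion_free P.
Proof.
move=> sBP /and3P[nabB /forall_inP expB /forall_inP invB].
have [x Bx [y By nCxy]] :
    exists2 x, x \in B & exists2 y, y \in B & [~ x, y] != 1.
  case/subsetPn: nabB => x Bx nCx; exists x => //.
  apply/exists_inP; apply/contraR: nCx => /exists_inPn nC.
  by apply/centP=> y /nC; rewrite negbK => /commgP.
have ZP z : z \in 'Z(B) -> forall t, t \in B -> commute z t.
  by case/setIP=> _ /centP.
have sqZ z : z \in B -> z ^+ 2 \in 'Z(B) by case/expB/andP.
have sq1 z : z \in B -> (z ^+ 2) ^+ 2 = 1.
  by case/expB/andP=> /eqP z4 _; rewrite -expgM.
have sqN1 z t : z \in B -> t \in B -> [~ z, t] != 1 -> z ^+ 2 != 1.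
  move=> Bz Bt; apply: contra => z2; apply/commgP.
  exact: ZP (implyP (invB z Bz) z2) t Bt.
pose a := x ^+ 2; pose b := y ^+ 2; pose c := [~ x, y].
have Za : a \in 'Z(B) by apply: sqZ.
have Zb : b \in 'Z(B) by apply: sqZ.
have Zc : c \in 'Z(B).
  (* The commutator is a product of squares, hence central. *)
  suffices -> : c = (x ^+ 2)^-1 * (x * y^-1) ^+ 2 * y ^+ 2.
    have Bxy : x * y^-1 \in B by rewrite groupM ?groupV.
    exact: groupM (groupM (groupVr (sqZ _ Bx)) (sqZ _ Bxy)) (sqZ _ By).
  by rewrite /c commgEl /conjg !expgS !expg0 !mulg1 invMg !mulgA !mulgKV.
have c2 : c ^+ 2 = 1.
  have : (x ^+ 2) ^ y = x ^+ 2 by rewrite -/a /conjg (ZP a Za y By) mulKg.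
  have -> : (x ^+ 2) ^ y = (x * c) ^+ 2 by rewrite conjXg /c commgEl mulKVg.
  rewrite expgMn; last exact/commute_sym/ZP.
  by move/(canRL (mulKg _)); rewrite mulVg.
have yx2 : (y * x) ^+ 2 = b * a * c.
  by rewrite expMg_Rmul //; [exact/commute_sym/ZP | exact/commute_sym/ZP].
have nt_abc : b * a * c != 1.
  rewrite -yx2 (sqN1 _ x) ?groupM //; apply: contra nCxy => /commgP Cyx.
  apply/commgP/commute_sym; apply: (mulIg x); rewrite /commute in Cyx.
  by rewrite Cyx mulgA.
have nt_a : a != 1 by apply: sqN1 nCxy.
have nt_b : b != 1 by apply: (sqN1 _ x); rewrite // -invg_comm invg_eq1.
have aa : a ^+ 2 = 1 by apply: sq1.
have bb : b ^+ 2 = 1 by apply: sq1.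
have Bb : b \in B by apply: groupX.
have Bc : c \in B by apply: groupR.
have abE : a * b = b * a by apply: ZP.
have bcE : b * c = c * b by apply: ZP.
have abab : (a * b) ^+ 2 = 1 by rewrite (expgMn 2 abE) aa bb mulg1.
have bcbc : (b * c) ^+ 2 = 1 by rewrite (expgMn 2 bcE) c2 bb mulg1.
pose A := (<[a * b]> <*> <[b * c]>)%G.
have Zab : a * b \in 'Z(B) := groupM Za Zb.
have sAZ : A \subset 'Z(B) by rewrite join_subG !cycle_subG Zab (groupM Zb Zc).
have cab : commute (a * b) (b * c) := ZP _ Zab _ (groupM Bb Bc).
have notAc : c \notin A.
  rewrite /A /= cent_joinEr; last by rewrite cent_cycle cycle_subG; apply/cent1P.
  have cyc2 (z t : gT) : z ^+ 2 = 1 -> t \in <[z]> -> t = 1 \/ t = z.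
    move=> z2 /cycleP[i ->]; rewrite -(odd_double_half i) -mul2n expgD expgM z2.
    by rewrite expg1n mulg1; case: (odd i); [right | left].
  (* A = {1, a b, b c, a c}, and c in A would make c, b, a b c or a trivial. *)
  apply/negP=> /mulsgP[u v /(cyc2 _ _ abab) Du /(cyc2 _ _ bcbc) Dv].
  case: Du Dv => -> [] ->; rewrite ?mulg1 ?mul1g => Dc.
  - by rewrite -/c Dc eqxx in nCxy.
  - by case/eqP: nt_b; apply: (mulIg c); rewrite mul1g.
  - by case/eqP: nt_abc; rewrite -abE -Dc.
  case/eqP: nt_a; apply: (mulIg c); rewrite mul1g.
  by move: Dc; rewrite mulgA -(mulgA a b b) (bb : b * b = 1) mulg1.
pose B0 := (<[x]> <*> <[y]>)%G.
have sB0 : B0 \subset B by rewrite join_subG !cycle_subG Bx.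
have B0x : x \in B0 by rewrite mem_gen // inE cycle_id.
have B0y : y \in B0 by rewrite mem_gen // inE cycle_id orbT.
have nAB0 : A <| B0.
  rewrite /normal (subset_trans sB0) ?andbT; last first.
    by rewrite cents_norm // centsC; apply: subset_trans sAZ (subsetIr _ _).
  have B0b : b \in B0 := groupX 2 B0y.
  rewrite join_subG !cycle_subG (groupM (groupX 2 B0x) B0b).
  by rewrite (groupM B0b) // groupR.
have nAx := subsetP (normal_norm nAB0) _ B0x.
have nAy := subsetP (normal_norm nAB0) _ B0y.
have nab : ~~ abelian (B0 / A).
  apply: contra notAc => /centsP cB0A.
  have /commgP/eqP := cB0A _ (mem_quotient A B0x) _ (mem_quotient A B0y).
  by rewrite -morphR //; apply: coset_idr; rewrite groupR.
rewrite negb_forall; apply/existsP; exists B0.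
rewrite negb_forall; apply/existsP; exists A%G.
rewrite nAB0 (subset_trans sB0 sBP) negbK /=.
(* Modulo A, a = b = c, so y^2 = x^2 and x^y = x^-1: the presentation of Q_8. *)
have homQ : B0 / A \homg 'Q_8.
  rewrite (@Grp_quaternion 3) //; apply/existsP.
  exists (coset A x, coset A y); rewrite /= !xpair_eqE.
  rewrite -!quotient_cycle // -quotientY ?cycle_subG // eqxx /=.
  rewrite -!morphX ?sq1 // -?morphJ -?morphV //=.
  have Aab : a * b \in A by rewrite mem_gen // inE cycle_id.
  have Aac : a * c \in A.
    have -> : a * c = a * b * (b * c).
      by rewrite (mulgA (a * b) b c) -(mulgA a b b) (bb : b * b = 1) mulg1.
    by rewrite groupM // mem_gen // inE cycle_id orbT.
  rewrite (_ : y ^+ 2 = a * b * a); last first.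
    by rewrite -/b abE -(mulgA b a a) (aa : a * a = 1) mulg1.
  rewrite (coset_kerl _ Aab) (_ : x ^ y = x^-1 * (a * c)); last first.
    by rewrite /a /c commgEl expgS expg1 -!mulgA mulKg mulKVg.
  have x4 : x ^+ (2 ^ 2) = 1 by case/andP: (expB x Bx) => /eqP.
  by rewrite (coset_kerr _ Aac) x4 morph1 !eqxx.
have c8 : #|[set: 'Q_8]| = 8 by apply: (@card_quaternion 3).
have /(dvdn_pfactor _ 3 (isT : prime 2))[m le_m3 cardBA] : #|B0 / A| %| 2 ^ 3.
  by rewrite -[(2 ^ 3)%N]c8 card_homg.
rewrite isogEcard homQ c8 leqNgt; apply: contra nab => lt8.
apply: (@p2group_abelian _ 2); first by rewrite /pgroup cardBA pnatX pnat_id.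
by rewrite cardBA pfactorK //; rewrite cardBA (ltn_exp2l m 3) in lt8.
Qed.

(** * Coprime action on p-groups *)

(* The flag b is to be ~~ quaternion_free P.                                    *)
Definition special_elt (gT : finGroupType) (b : bool) (p : nat) (x : gT) :=
  (#[x] == p) || b && (#[x] == 4).

Section CommutatorExponent.

Variables (gT : finGroupType) (p : nat) (R D K : {group gT}).
Hypotheses (pr_p : prime p) (pR : p.-group R) (nKR : K <| R).
Hypotheses (sPhiK : 'Phi(R) \subset K) (cDK : D \subset 'C(K)).
Hypothesis defR : [~: R, D] = R.

(** Three subgroups: [K, D, R] = 1 and [R, K, D] <= [K, D] = 1 force [R, D, K] = [R, K] = 1. *)
Lemma perfect_action_central : K \subset 'Z(R).
Proof.
rewrite subsetI normal_sub //=; apply/commG1P.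
rewrite -[in [~: _, _]]defR commGC; apply: three_subgroup.
  by rewrite (commG1P cDK) comm1G.
apply/commG1P; rewrite centsC; apply: subset_trans cDK (centS _).
by rewrite commg_subl normal_norm.
Qed.

(* p divides 'C(e, 2), which kills the commutator term in (x y)^e.              *)
Let e := if p == 2 then 4 else p.

Let dvd_p_e : p %| e.
Proof. by rewrite /e; case: eqP => [-> | _]. Qed.

Let dvd_p_bin : p %| 'C(e, 2).
Proof.
rewrite /e; case: eqP => [-> // | /eqP p'2].
by apply: prime_dvd_bin => //=; rewrite ltn_neqAle eq_sym p'2 prime_gt1.
Qed.

(** Commutators are central of order dividing p, so taking e-th powers is an endomorphism of R. It
    kills the generators [y, a] of [R, D] = R, because y^e lies in K and is fixed by a. *)
Lemma perfect_action_exponent x : x \in R -> x ^+ e = 1.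
Proof.
have sKZ := perfect_action_central.
have sR'Z : R^`(1) \subset 'Z(R).
  apply: subset_trans sKZ; apply: subset_trans sPhiK.
  by rewrite (Phi_joing pR) joing_subl.
have ZP z t : z \in 'Z(R) -> t \in R -> commute t z.
  by case/setIP=> _ /centP cz /cz.
have RpK z : z \in R -> z ^+ p \in K.
  move=> Rz; apply: (subsetP sPhiK); rewrite (Phi_joing pR) mem_gen // inE.
  by rewrite orbC (Mho_p_elt 1) ?expn1 // (mem_p_elt pR).
have RZ y z : y \in R -> z \in R -> [~ y, z] \in 'Z(R).
  by move=> Ry Rz; rewrite (subsetP sR'Z) // mem_commg.
have Rbin y z : y \in R -> z \in R -> [~ y, z] ^+ 'C(e, 2) = 1.
  move=> Ry Rz; have /dvdnP[k ->] := dvd_p_bin; rewrite mulnC expgM.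
  have cy : commute y [~ y, z] by apply: ZP; rewrite ?RZ.
  rewrite -(commXg p cy).
  have /commgP/eqP -> : commute (y ^+ p) z.
    by apply/commute_sym/ZP; rewrite ?(subsetP sKZ) ?RpK.
  by rewrite expg1n.
have expM y z : y \in R -> z \in R -> (y * z) ^+ e = y ^+ e * z ^+ e.
  move=> Ry Rz; have Zzy := RZ _ _ Rz Ry.
  by rewrite expMg_Rmul ?Rbin ?mulg1 //; apply: ZP.
pose A := [set y in R | y ^+ e == 1].
have gA : group_set A.
  apply/group_setP; split=> [|y z]; first by rewrite inE group1 expg1n eqxx.
  rewrite !inE => /andP[Ry /eqP ye] /andP[Rz /eqP ze].
  by rewrite groupM //= expM // ye ze mulg1.
suffices /subsetP sRA : R \subset Group gA.
  by move/sRA; rewrite inE => /andP[_ /eqP].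
rewrite -[in X in X \subset _]defR gen_subG; apply/subsetP=> _ /imset2P[y a Ry Da ->].
have Rya : y ^ a \in R.
  by rewrite -(mulKVg y (y ^ a)) -commgEl groupM // -defR mem_commg.
rewrite inE commgEl groupM ?groupV //= expM ?groupV // expgVn -conjXg.
have Ke : y ^+ e \in K.
  by have /dvdnP[k ->] := dvd_p_e; rewrite mulnC expgM groupX ?RpK.
by rewrite /conjg -(centP (subsetP cDK a Da)) // mulKg mulVg.
Qed.

(** If p = 2 and b is false, an involution outside K is wanted. For R abelian, some [y, a] will do,
    as [y, a]^2 = [y^2, a] = 1. If R is nonabelian and has none, its involutions lie in K <= Z(R),
    and R is quaternion-like. *)
Lemma perfect_action_special (b : bool) :
    ~~ (R \subset K) -> b || quaternion_like_free R ->
  (forall x, x \in R -> x != 1 -> special_elt b p x)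
  \/ p = 2 /\ exists x, [/\ x \in R, x \notin K & #[x] = 2].
Proof.
move=> not_sRK; have := perfect_action_exponent; rewrite /e /special_elt.
case: (p =P 2) => [p2 exp4 | _ expp _]; last first.
  by left=> x Rx ntx; rewrite (nt_prime_order pr_p) ?expp ?eqxx.
case: b => /= [_ | freeR].
  left=> x /exp4; rewrite p2 -order_eq1 => /eqP; rewrite -order_dvdn => dv4.
  by have := dvdn_leq (isT : 0 < 4)%N dv4; move: dv4; case: #[x] => [|[|[|[|[|]]]]].
right; split=> //; have sKZ := perfect_action_central.
have RpK z : z \in R -> z ^+ 2 \in K.
  move=> Rz; apply: (subsetP sPhiK); rewrite (Phi_joing pR) mem_gen // inE.
  by rewrite orbC -p2 (Mho_p_elt 1) ?expn1 // (mem_p_elt pR).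
have inv2 z : z ^+ 2 = 1 -> z \notin K -> #[z] = 2.
  by move=> z2 notKz; apply: nt_prime_order => //; apply: contraNneq notKz => ->.
have [cRR | not_cRR] := boolP (abelian R).
  have : ~~ ([~: R, D] \subset K) by rewrite defR.
  rewrite gen_subG; case/subsetPn=> _ /imset2P[y a Ry Da ->] notK.
  have RR : [~ y, a] \in R by rewrite -defR mem_commg.
  exists [~ y, a]; split=> //; apply: inv2 => //.
  have Rya : y ^ a \in R by rewrite -(mulKVg y (y ^ a)) -commgEl groupM.
  rewrite commgEl expgMn; last by apply: (centsP cRR); rewrite ?groupV.
  rewrite expgVn -conjXg /conjg -(centP (subsetP cDK a Da)) ?RpK //.
  by rewrite mulKg mulVg.
have [/exists_inP[x Rx /andP[notKx /eqP x2]] | /exists_inPn invK] :=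
    boolP [exists x in R, (x \notin K) && (x ^+ 2 == 1)].
  by exists x; split=> //; apply: inv2.
case/negP: (implyP (forallP freeR R) (subxx R)).
apply/and3P; split=> //; apply/forall_inP=> x Rx.
  by rewrite exp4 // eqxx (subsetP sKZ) ?RpK.
apply/implyP=> x2; apply: (subsetP sKZ).
by have := invK x Rx; rewrite x2 andbT negbK.
Qed.

End CommutatorExponent.

Lemma special_elt_order_p (gT : finGroupType) b p (x : gT) :
  #[x] = p -> special_elt b p x.
Proof. by rewrite /special_elt => ->; rewrite eqxx. Qed.

Lemma special_eltJ (gT : finGroupType) b p (x y : gT) :
  special_elt b p (x ^ y) = special_elt b p x.
Proof. by rewrite /special_elt orderJ. Qed.

(** With z = [x, a] one has x^(a^n) = x z^n; for n the order of a this gives z^n = 1, so the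
    p-element z is trivial. *)
Lemma coprime_stable_cent (gT : finGroupType) p (x a : gT) :
  p.-elt [~ x, a] -> p^'.-elt a -> commute [~ x, a] a -> commute x a.
Proof.
set z := [~ x, a] => pz p'a cza.
have xaE : x ^ a = x * z by rewrite /z commgEl mulKVg.
clearbody z; have zaE : z ^ a = z by rewrite /conjg cza mulKg.
have xa n : x ^ (a ^+ n) = x * z ^+ n.
  elim: n => [|n IHn]; first by rewrite conjg1 mulg1.
  by rewrite expgSr conjgM IHn conjMg conjXg zaE xaE expgS mulgA.
have := xa #[a]; rewrite expg_order conjg1 -{1}[x]mulg1 => /mulgI/esym/eqP.
rewrite -order_dvdn => dv_za; apply/commgP.
rewrite commgEl xaE mulKg -order_eq1.
by rewrite -dvdn1 -(eqnP (pnat_coprime pz p'a)) dvdn_gcd dvdnn.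
Qed.

(** In a minimal counterexample [U, a] = U and, by induction, a centralises 'Phi(U). Then
    ['C_U(<[a]>)] can serve as K in [perfect_action_special], which yields a special element outside
    it. *)
Lemma special_centralised (gT : finGroupType) b p (U : {group gT}) a :
    prime p -> p.-group U -> a \in 'N(U) -> p^'.-elt a ->
    b || quaternion_like_free U ->
    (forall x, x \in U -> special_elt b p x -> commute x a) ->
  U \subset 'C[a].
Proof.
move=> pr_p; move: {2}_.+1 (ltnSn #|U|) => n.
elim: n U => // n IHn U leUn pU nUa p'a freeU csU.
have IH (V : {group gT}) : V \proper U -> a \in 'N(V) -> V \subset 'C[a].
  move=> ltVU nVa; have sVU := proper_sub ltVU.
  apply: IHn => //; rewrite ?(pgroupS sVU) //.
  - exact: leq_trans (proper_card ltVU) _.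
  - by case/orP: freeU => [-> // | /(quaternion_like_freeS sVU) ->]; rewrite orbT.
  by move=> x Vx; apply: csU (subsetP sVU x Vx).
have nUA : <[a]> \subset 'N(U) by rewrite cycle_subG.
rewrite -cent_cycle; have [ltRU | ] := boolP ([~: U, <[a]>] \proper U).
  have := IH [~: U, <[a]>]%G ltRU.
  move/(_ (subsetP (commg_normr <[a]> U) a (cycle_id a))) => cR.
  rewrite cent_cycle; apply/subsetP=> x Ux.
  have Rx : [~ x, a] \in [~: U, <[a]>] by rewrite mem_commg ?cycle_id.
  apply/cent1P/(@coprime_stable_cent _ p) => //.
    by rewrite (mem_p_elt pU) // (subsetP (proper_sub ltRU)).
  exact/cent1P/(subsetP cR).
rewrite properEneq commg_subl nUA andbT negbK => /eqP defU.
apply/idPn => not_cUa.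
have ntU : U :!=: 1 by apply: contraNneq not_cUa => ->; rewrite sub1G.
have sPhiC : 'Phi(U) \subset 'C_U(<[a]>).
  rewrite subsetI Phi_sub cent_cycle IH ?Phi_proper //.
  by apply: (subsetP (char_norm_trans (Phi_char U) nUA)); apply: cycle_id.
have nCU : 'C_U(<[a]>) <| U.
  apply: sub_der1_normal (subsetIl _ _); apply: subset_trans sPhiC.
  by rewrite (Phi_joing pU) joing_subl.
have cAC : <[a]> \subset 'C('C_U(<[a]>)) by rewrite centsC subsetIr.
have not_sUC : ~~ (U \subset 'C_U(<[a]>)) by rewrite subsetI subxx.
have [sp | [p2 [x [Ux notCx ox]]]] :=
    perfect_action_special pr_p pU nCU sPhiC cAC defU not_sUC freeU.
  case/negP: not_cUa; rewrite cent_cycle; apply/subsetP=> x Ux.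
  have [-> | ntx] := eqVneq x 1; first exact: group1.
  by apply/cent1P/csU => //; apply: sp.
case/negP: notCx; apply/setIP; split=> //=; rewrite cent_cycle; apply/cent1P/csU => //.
by rewrite p2; apply: special_elt_order_p.
Qed.

(** * Scalar actions on elementary abelian groups *)

Section PowerEigenvector.

Import GRing.Theory.

(* The matrix A of g satisfies A^p = A, that is, \prod_c (A - c) = 0 over F_p.  *)
Lemma exists_power_eigenvector (gT : finGroupType) p (V : {group gT}) g :
    prime p -> p.-abelem V -> V :!=: 1 -> g \in 'N(V) ->
    g ^+ p.-1 \in 'C(V) ->
  exists v i, [/\ v \in V, v != 1 & v ^ g = v ^+ i].
Proof.
move=> pr_p abV ntV nVg cVg.
have nVG : <[g]> \subset 'N(V) by rewrite cycle_subG.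
pose rG := abelem_repr abV ntV nVG; have Gg := cycle_id g.
pose A := rG g.
have gpE : g ^+ p = g ^+ p.-1 * g by rewrite -expgSr (prednK (prime_gt0 pr_p)).
have Ap : (A ^+ p = A)%R.
  rewrite -repr_mxX // gpE.
  apply/row_matrixP => i; rewrite !rowE.
  apply: (@rVabelem_inj _ _ _ abV ntV).
  rewrite !rVabelemJ ?groupM ?groupX // conjgM; congr (_ ^ _).
  by rewrite /conjg -(centP cVg) ?mulKg // mem_rVabelem.
have prodA : (\prod_(c : 'F_p) (A - c%:M) = 0)%R.
  have genP : ('X^p - 'X = \prod_(c : 'F_p) ('X - c%:P) :> {poly 'F_p})%R.
    by rewrite -finField_genPoly card_Fp.
  have := congr1 (horner_mx A) genP.
  rewrite rmorph_prod rmorphB rmorphXn /= horner_mx_X Ap subrr => ->.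
  by apply: eq_bigr => c _; rewrite rmorphB /= horner_mx_X horner_mx_C.
have /existsP[c /det0P[u nz_u uA]] :
    [exists c : 'F_p, (\det (A - c%:M) == 0)%R].
  apply: contra_eqT prodA; rewrite negb_exists => /forallP detA.
  suffices : (\det (\prod_(c : 'F_p) (A - c%:M)) != 0)%R.
    by apply: contraNneq => ->; rewrite det0.
  apply: (big_ind (fun M => \det M != 0)%R) => [|M N|c _]; last exact: detA.
    by rewrite det1 oner_neq0.
  by rewrite det_mulmx; apply: mulf_neq0.
exists (rVabelem abV ntV u), c; split.
- exact: mem_rVabelem.
- by rewrite -(rVabelem0 abV ntV) (inj_eq (@rVabelem_inj _ _ _ abV ntV)).
move/eqP: uA; rewrite mulmxBr subr_eq0 mul_mx_scalar => /eqP uA.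
by rewrite -(rVabelemJ abV ntV nVG) // -rVabelemZ -uA.
Qed.

(** G induces an abelian group on V, so an eigenspace W of g is G-invariant and equals V by
    minimality. Every g is thus scalar, and any line is G-invariant. *)
Lemma minnormal_scalar_action (gT : finGroupType) p (V G : {group gT}) :
    prime p -> p.-abelem V -> minnormal V G ->
    {in G &, forall g h, [~ g, h] \in 'C(V)} ->
    {in G, forall g, g ^+ p.-1 \in 'C(V)} ->
  #|V| = p.
Proof.
move=> pr_p abV /mingroupP[/andP[ntV nVG] minV] cV pV.
have [pV' cVV _] := and3P abV.
have powG g : g \in G -> exists i, forall v, v \in V -> v ^ g = v ^+ i.
  move=> Gg; have nVg := subsetP nVG g Gg.
  have [v [i [Vv ntv vg]]] := exists_power_eigenvector pr_p abV ntV nVg (pV g Gg).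
  exists i; pose W := [set w in V | w ^ g == w ^+ i].
  have gW : group_set W.
    apply/group_setP; split=> [|x y]; first by rewrite inE group1 conj1g expg1n eqxx.
    rewrite !inE => /andP[Vx /eqP xg] /andP[Vy /eqP yg].
    by rewrite groupM //= conjMg xg yg expgMn //; apply: (centsP cVV).
  suffices /setP defW : Group gW :=: V.
    by move=> w Vw; have := defW w; rewrite inE Vw => /eqP.
  apply: minV; last by apply/subsetP=> w; rewrite inE => /andP[].
  apply/andP; split.
    apply/trivgPn; exists v => //; by rewrite inE Vv vg eqxx.
  apply/subsetP=> h Gh; rewrite inE; apply/subsetP=> _ /imsetP[w Ww ->].
  move: Ww; rewrite !inE => /andP[Vw /eqP wg].
  have Vwh : w ^ h \in V by rewrite memJ_norm // (subsetP nVG).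
  rewrite Vwh /= -conjXg -wg -!conjgM.
  rewrite (commgC h g) [w ^ (_ * _)]conjgM {1}/conjg -(centP (cV h g Gh Gg)) ?mulKg //.
  by rewrite memJ_norm ?groupM // (subsetP nVG) ?groupM.
have [v Vv ntv] := trivgPn _ ntV.
suffices <- : <[v]> = V.
  by apply: nt_prime_order ntv => //; case/(abelemP pr_p): abV => _ ->.
apply: (minV <[v]>%G); last by rewrite cycle_subG.
rewrite cycle_eq1 ntv /=; apply/subsetP=> g Gg; rewrite inE -cycleJ cycle_subG.
by have [i ->] := powG g Gg; rewrite ?mem_cycle.
Qed.

End PowerEigenvector.

(** * Chief factors *)

Section ChiefFactors.

Variables (gT : finGroupType) (G : {group gT}).
Implicit Types H K L M : {group gT}.

Lemma chief_factorP K L :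
  reflect [/\ K <| G, L <| G, K \proper L &
             forall H, H <| G -> K \subset H -> H \subset L ->
               H :=: K \/ H :=: L]
          (chief_factor G K L).
Proof.
apply: (iffP andP) => [[/maxgroupP[/andP[ltKL nKG] maxK] nLG] |
                       [nKG nLG ltKL maxK]].
  have sLG := normal_sub nLG.
  split=> //; first by rewrite /normal nKG (subset_trans (proper_sub ltKL)).
  move=> H nHG sKH sHL; have [-> | neHL] := eqVneq (H : {set gT}) L; first by right.
  by left; apply: maxK; rewrite ?properEneq ?neHL ?sHL ?normal_norm.
split=> //; apply/maxgroupP; split=> [|H /andP[ltHL nHG] sKH].
  by rewrite ltKL normal_norm.
have nsHG : H <| G by rewrite /normal nHG (subset_trans (proper_sub ltHL)) ?normal_sub.
have [//|defH] := maxK H nsHG sKH (proper_sub ltHL).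
by rewrite defH properxx in ltHL.
Qed.

Lemma chief_factor_setI K L M :
    chief_factor G K L -> M <| G -> M \subset L -> ~~ (M \subset K) ->
  chief_factor G (M :&: K) M /\ #|L : K| = #|M : M :&: K|.
Proof.
case/chief_factorP=> nKG nLG /andP[sKL _] minL nMG sML not_sMK.
have nKM : M \subset 'N(K) := subset_trans (normal_sub nMG) (normal_norm nKG).
have defL : M * K = L.
  rewrite -norm_joinEl //.
  have [||| /= defK | //] := minL (M <*> K)%G; first by rewrite normalY.
  - exact: joing_subr.
  - by rewrite join_subG sML.
  by case/negP: not_sMK; rewrite -defK joing_subl.
split; last by rewrite -defL (normC nKM) indexMg indexgI.
apply/chief_factorP; split; rewrite ?normalI //.
  by rewrite properE subsetIl subsetI subxx.
move=> H nHG sMKH sHM.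
have nKH : H \subset 'N(K) := subset_trans sHM nKM.
have [||| /= defHK | /= defHK] := minL (H <*> K)%G; first by rewrite normalY.
- exact: joing_subr.
- by rewrite join_subG sKL (subset_trans sHM).
- left; apply/eqP; rewrite eqEsubset sMKH andbT subsetI sHM -defHK.
  exact: joing_subl.
right; apply/eqP; rewrite eqEsubset sHM /=.
have: M \subset (H <*> K) :&: M by rewrite defHK subsetI sML subxx.
by rewrite norm_joinEl // -group_modl // [K :&: M]setIC mulGSid.
Qed.

Lemma chief_factor_cyclic p K L x :
    prime p -> chief_factor G K L -> x \in L -> x \notin K -> x ^+ p \in K ->
    G \subset 'N(<[x]> <*> K) ->
  #|L : K| = p.
Proof.
move=> pr_p /chief_factorP[nKG nLG /andP[sKL _] minL] Lx notKx Kxp nxKG.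
have nKL : L \subset 'N(K) := subset_trans (normal_sub nLG) (normal_norm nKG).
have sxKL : <[x]> <*> K \subset L by rewrite join_subG cycle_subG Lx.
have Kx : x \in 'N(K) := subsetP nKL x Lx.
have defL : <[x]> <*> K = L.
  have [||| /= defK | //] := minL (<[x]> <*> K)%G.
  - by rewrite /normal (subset_trans sxKL (normal_sub nLG)).
  - exact: joing_subr.
  - exact: sxKL.
  by case/negP: notKx; rewrite -defK mem_gen // inE cycle_id.
rewrite -card_quotient // -defL quotientYidr ?cycle_subG // quotient_cycle //.
apply: nt_prime_order => //; first by rewrite -morphX //= coset_id.
by apply: contra notKx => /eqP; apply: coset_idr.
Qed.

(** [L / K] is a nontrivial normal subgroup of the p-group [S / K], so it meets the centre. *)
Lemma chief_factor_central (p : nat) (S K L : {group gT}) :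
    chief_factor G K L -> p.-group L -> p.-Sylow(G) S ->
  exists x, [/\ x \in L, x \notin K & {in S, forall s, [~ x, s] \in K}].
Proof.
case/chief_factorP=> nKG nLG ltKL _ pL sylS.
have [sSG pS _] := and3P sylS.
have sLS : L \subset S by apply: normal_sub_max_pgroup (Hall_max sylS) pL nLG.
have nKS : S \subset 'N(K) := subset_trans sSG (normal_norm nKG).
have ntLK : L / K != 1.
  by rewrite -subG1 quotient_sub1 ?(subset_trans sLS nKS) //; case/andP: ltKL.
have nLKS : L / K <| S / K by rewrite quotient_normal // (normalS sLS sSG).
have := meet_center_nil (quotient_nil K (pgroup_nil pS)) nLKS ntLK.
case/trivgPn=> _ /setIP[/morphimP[x Nx Lx ->] /setIP[_ cx]] ntx.
exists x; split=> // [|s Ss]; first by apply: contraNN ntx => Kx; apply/eqP/coset_id.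
have Ns := subsetP nKS s Ss.
apply: coset_idr; first by rewrite groupR.
by rewrite morphR //; apply/eqP/commgP/(centP cx)/mem_quotient.
Qed.

End ChiefFactors.

(* What the partial Pi-property of <[x]> says at the last term N of the chief   *)
(* series that does not contain x.                                              *)
Definition partial_Pi_elt (gT : finGroupType) (p : nat) (G : {group gT}) (x : gT) :=
  exists2 N : {group gT}, N <| G &
    x \notin N /\ p.-nat #|G : 'N_G(<[x]> <*> N)|.

Section PartialPi.

Variables (gT : finGroupType) (p : nat) (G : {group gT}).
Implicit Types H K L M : {group gT}.

(** Since x is not in N, [N :&: L] is proper in L, hence inside K. By Dedekind's law <x> K = (<x> N
    :&: L) K, so elements of G normalising <x> N also normalise <x> K. *)
Lemma partial_Pi_elt_norm K L x :
    partial_Pi_elt p G x -> K <| G -> L <| G -> x \in L ->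
    (forall N : {group gT}, N <| G -> N \proper L -> N \subset K) ->
  p.-nat #|G : 'N_G(<[x]> <*> K)|.
Proof.
case=> N nNG [notNx pT] nKG nLG Lx minL; apply: pnat_dvd pT.
have sxL : <[x]> \subset L by rewrite cycle_subG.
have nNx : <[x]> \subset 'N(N).
  by rewrite (subset_trans sxL) // (subset_trans (normal_sub nLG)) ?normal_norm.
apply: indexgS; rewrite subsetI subsetIl /=.
have sNLK : N :&: L \subset K.
  apply: minL; first exact: normalI.
  rewrite properE subsetIr subsetI subxx andbT.
  by apply: contra notNx => /subsetP->.
have nT H : H <| G -> 'N_G(<[x]> <*> N) \subset 'N(H).
  by move=> nHG; rewrite subIset // normal_norm.
have -> : <[x]> <*> K = ((<[x]> <*> N) :&: L) <*> K.
  rewrite (norm_joinEl nNx) -group_modl //; apply/eqP.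
  rewrite eqEsubset !join_subG !joing_subr !andbT mul_subG ?joing_subl //.
    by rewrite (subset_trans (mulG_subl (N :&: L) _)) ?joing_subl.
  by rewrite (subset_trans sNLK) ?joing_subr.
by apply: normsY; [apply: normsI; [apply: subsetIr | apply: nT] | apply: nT].
Qed.

Lemma pnat_index_mul (T S : {group gT}) :
  p.-nat #|G : T| -> T \subset G -> p.-Sylow(G) S -> T * S = G.
Proof.
move=> pT sTG /and3P[sSG _ p'S]; apply: coprime_index_mulG => //.
exact: pnat_coprime pT p'S.
Qed.

(** G = N_G(H) S for a Sylow subgroup S containing H, so all conjugates of H lie in S, and H lies in
    all conjugates of S. *)
Lemma pnat_index_pcore H :
  H \subset G -> p.-group H -> p.-nat #|G : 'N_G(H)| -> H \subset 'O_p(G).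
Proof.
move=> sHG pH pN; apply/bigcapsP=> M maxM.
have [S sylS sHS] := Sylow_superset sHG pH.
have [g Gg ->] := Sylow_trans sylS (etrans (esym (max_pgroup_Sylow _ _ _)) maxM).
have : g^-1 \in 'N_G(H) * S by rewrite (pnat_index_mul pN) ?groupV ?subsetIl.
case/mulsgP=> t s /setIP[_ nHt] Ss /(canRL (@invgK _)) ->.
by rewrite -sub_conjg conjsgM (normP nHt) conj_subG.
Qed.

End PartialPi.

Lemma prime_norm_cent (gT : finGroupType) (V : {group gT}) :
    prime #|V| ->
  {in 'N(V), forall g, g ^+ #|V|.-1 \in 'C(V)}
  /\ {in 'N(V) &, forall g h, [~ g, h] \in 'C(V)}.
Proof.
move=> prV; have cycV := prime_cyclic prV.
rewrite -ker_conj_aut; split=> [g Ng | g h Ng Nh].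
  apply/kerP; rewrite ?groupX ?morphX //.
  apply/eqP; rewrite -order_dvdn -totient_prime // -card_Aut_cyclic //.
  by apply/order_dvdG/Aut_aut.
apply/kerP; rewrite ?groupR ?morphR //; apply/eqP/commgP.
by apply: (centsP (Aut_cyclic_abelian cycV)); apply: Aut_aut.
Qed.

Lemma mem_astabQP (gT : finGroupType) (K L : {group gT}) g :
    L \subset 'N(K) -> g \in 'N(K) ->
  reflect {in L, forall x, [~ x, g] \in K} (g \in 'C(L / K | 'Q)).
Proof.
move=> nKL nKg; rewrite astabQ morphpreE inE nKg [_ \in _]inE /=.
apply: (iffP centP) => [cg x Lx | cg _ /morphimP[x Nx Lx ->]].
  have Nx := subsetP nKL x Lx; apply: coset_idr; first by rewrite groupR.
  by rewrite morphR //; apply/eqP/commgP/commute_sym/cg/mem_quotient.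
by apply/commute_sym/commgP; rewrite -morphR //= coset_id ?cg.
Qed.

(** * Chief factors inside p-groups *)

Section OrderP.

Variables (gT : finGroupType) (p : nat) (G : {group gT}).
Hypothesis pr_p : prime p.
Implicit Types K L M : {group gT}.

Lemma chief_factors_cent K a :
    K <| G -> p.-group K -> p^'.-elt a -> a \in G ->
    (forall K1 L1, chief_factor G K1 L1 -> L1 \subset K ->
       {in L1, forall x, [~ x, a] \in K1}) ->
  K \subset 'C[a].
Proof.
move=> nKG pK p'a Ga stK.
suffices H n : forall M, M <| G -> M \subset K -> #|M| < n -> M \subset 'C[a].
  exact: H (ltnSn _).
elim: n => // n IHn M nMG sMK leMn.
have [-> | ntM] := eqVneq (M : {set gT}) 1; first exact: sub1G.
have [N maxN] : {N : {group gT} | maxnormal N M G}.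
  by apply: ex_maxgroup; exists 1%G; rewrite proper1G ntM norms1.
have chNM : chief_factor G N M by apply/andP.
have [nNG _ ltNM _] := chief_factorP _ _ _ chNM.
have sNM := proper_sub ltNM.
have cNa := IHn N nNG (subset_trans sNM sMK) (leq_trans (proper_card ltNM) leMn).
apply/subsetP=> x Mx; apply/cent1P/(@coprime_stable_cent _ p) => //.
  by rewrite (mem_p_elt pK) // (subsetP sMK) // (subsetP sNM) // (stK N M).
by apply/cent1P/(subsetP cNa)/(stK N M).
Qed.

(** Let A centralise all chief factors below K. Its p'-elements centralise K, hence [L / K], and
    then all of A does. Since the factors below K have order p, G / A is abelian of exponent
    dividing p - 1, so G acts on [L / K] by scalars. *)
Lemma chief_factor_order_p K L :
    chief_factor G K L -> p.-group L ->
    (forall K1 L1, chief_factor G K1 L1 -> L1 \subset K -> #|L1 : K1| = p) ->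
    {in 'C_G(K), forall a, p^'.-elt a -> {in L, forall x, [~ x, a] \in K}} ->
  #|L : K| = p.
Proof.
move=> chKL pL ordK cK; have [nKG nLG ltKL minL] := chief_factorP _ _ _ chKL.
have [sKG nKG'] := andP nKG; have [sLG nLG'] := andP nLG.
have sKL := proper_sub ltKL.
(* For K = 1 the intersection is over an empty family, hence everything; the leading [G] makes A =
   G. *)
pose A := (G :&: \bigcap_(F : {group gT} * {group gT}
   | chief_factor G F.1 F.2 && (F.2 \subset K)) 'C_G(F.2 / F.1 | 'Q))%G.
have sAG : A \subset G := subsetIl _ _.
have memA g : g \in G ->
  (forall K1 L1, chief_factor G K1 L1 -> L1 \subset K ->
     g \in 'C(L1 / K1 | 'Q)) ->
  g \in A.
  move=> Gg cg; apply/setIP; split=> //; apply/bigcapP=> [[K1 L1]] /andP[ch1 sK1].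
  by apply/setIP; split=> //; apply: cg.
have cAK a : a \in A -> forall K1 L1, chief_factor G K1 L1 -> L1 \subset K ->
    {in L1, forall x, [~ x, a] \in K1}.
  case/setIP=> Ga /bigcapP cA K1 L1 ch1 sL1.
  have /setIP[_] := cA (K1, L1) (introT andP (conj ch1 sL1)).
  have [/andP[_ nK1G] /andP[sL1G _] _ _] := chief_factorP _ _ _ ch1.
  by move/mem_astabQP; apply; [apply: subset_trans nK1G | apply: (subsetP nK1G)].
have nAG : G \subset 'N(A).
  rewrite normsI ?normG // norms_bigcap //; apply/bigcapsP=> [[K1 L1]] /andP[ch1 _].
  by have [nK1G nL1G _ _] := chief_factorP _ _ _ ch1; apply: factor_norm.
clearbody A; have nsAG : A <| G by rewrite /normal sAG.
have p'A a : a \in A -> p^'.-elt a -> {in L, forall x, [~ x, a] \in K}.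
  move=> Aa p'a; have Ga := subsetP sAG a Aa; apply: cK => //.
  rewrite inE Ga /= -sub_cent1.
  apply: chief_factors_cent (pgroupS sKL pL) p'a Ga _ => //.
  exact: cAK.
(* The stabiliser in A of a fixed point of S in L / K contains a Sylow          *)
(* q-subgroup of A for every prime q.                                           *)
have cAL : A \subset 'C(L / K | 'Q).
  have [S sylS] := Sylow_exists p G.
  have [x [Lx notKx cSx]] := chief_factor_central chKL pL sylS.
  have nKL : L \subset 'N(K) := subset_trans sLG nKG'.
  have nKA : A \subset 'N(K) := subset_trans sAG nKG'.
  have Nx := subsetP nKL x Lx.
  pose B := (A :&: coset K @*^-1 'C[coset K x])%G.
  have memB a : a \in A -> [~ x, a] \in K -> a \in B.
    move=> Aa Ka; have Na := subsetP nKA a Aa.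
    apply/setIP; split=> //; rewrite mem_morphpre //=; apply/cent1P.
    by apply/commute_sym/commgP; rewrite -morphR //= coset_id.
  have sAB : A \subset B.
    suffices dvAB : #|A| %| #|B|.
      suffices -> : B :=: A by [].
      by apply/eqP; rewrite eqEcard subsetIl dvdn_leq.
    apply/(dvdn_partP _ (cardG_gt0 A)) => q _.
    have [-> | p'q] := eqVneq q p.
      have sylSA := Hall_setI_normal nsAG sylS.
      rewrite -(card_Hall sylSA) cardSg //; apply/subsetP=> s /setIP[Ss As].
      by apply: memB => //; apply: cSx.
    have [R sylR] := Sylow_exists q A; have [sRA qR _] := and3P sylR.
    rewrite -(card_Hall sylR) cardSg //; apply/subsetP=> a Ra.
    have Aa := subsetP sRA a Ra; apply: memB (p'A a Aa _ x Lx) => //.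
    by apply: pi_pnat (mem_p_elt qR Ra) _.
  (* The fixed points of A in [L / K] are G-invariant and, thanks to x, nontrivial. *)
  pose W := (L :&: coset K @*^-1 'C(A / K))%G.
  have nWG : W <| G.
    rewrite /normal subIset ?sLG //= normsI //.
    apply: subset_trans (morphpre_norm _ _).
    by rewrite -sub_quotient_pre // norms_cent // quotient_norms.
  have Wx : x \in W.
    apply/setIP; split=> //=; apply: mem_morphpre => //=.
    apply/centP=> _ /morphimP[a Na Aa ->].
    by have /setIP[_] := subsetP sAB a Aa; rewrite /= morphpreE inE Na inE => /cent1P.
  have [||| /= defW | /= defW] := minL W.
  - exact: nWG.
  - by rewrite subsetI sKL sub_cosetpre.
  - exact: subsetIl.
  - by rewrite -defW Wx in notKx.
  rewrite astabQ -sub_quotient_pre // centsC sub_quotient_pre //.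
  by rewrite -[X in pred_of_set X]defW subsetIr.
have mLK := chief_factor_minnormal chKL.
have nKL : L \subset 'N(K) := subset_trans sLG nKG'.
have pLK : p.-group (L / K) := quotient_pgroup K pL.
have abLK : p.-abelem (L / K).
  rewrite -(is_abelem_pgroup pLK).
  by have [] := minnormal_solvable mLK (subxx _) (pgroup_sol pLK).
have prime_factor K1 L1 : chief_factor G K1 L1 -> L1 \subset K ->
    prime #|L1 / K1| /\ G / K1 \subset 'N(L1 / K1).
  move=> ch1 sL1; have [nK1G nL1G _ _] := chief_factorP _ _ _ ch1.
  have nK1L1 := subset_trans (normal_sub nL1G) (normal_norm nK1G).
  by rewrite card_quotient // (ordK _ _ ch1) // quotient_norms ?normal_norm.
have cA g : g \in G -> (forall K1 L1, chief_factor G K1 L1 -> L1 \subset K ->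
    coset K1 g \in 'C(L1 / K1)) -> coset K g \in 'C(L / K).
  move=> Gg cg.
  have /(subsetP cAL) : g \in A.
    apply: memA => // K1 L1 ch1 sL1; rewrite astabQ morphpreE inE [_ \in _ @^-1: _]inE.
    have [nK1G _ _ _] := chief_factorP _ _ _ ch1.
    by rewrite (subsetP (normal_norm nK1G)) //= cg.
  by rewrite astabQ morphpreE inE => /andP[_]; rewrite inE.
rewrite -card_quotient //; apply: (minnormal_scalar_action pr_p abLK mLK).
  move=> _ _ /morphimP[g Ng Gg ->] /morphimP[h Nh Gh ->] /=.
  rewrite -morphR //=; apply: cA; first exact: groupR.
  move=> K1 L1 ch1 sL1; have [pr1 nL1] := prime_factor _ _ ch1 sL1.
  have [nK1G _ _ _] := chief_factorP _ _ _ ch1.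
  have nK1 := subsetP (normal_norm nK1G).
  rewrite morphR ?nK1 //; have [_] := prime_norm_cent pr1; apply.
    by rewrite (subsetP nL1) ?mem_quotient.
  by rewrite (subsetP nL1) ?mem_quotient.
move=> _ /morphimP[g Ng Gg ->].
rewrite -morphX //=; apply: cA; first exact: groupX.
move=> K1 L1 ch1 sL1; have [pr1 nL1] := prime_factor _ _ ch1 sL1.
have [nK1G nL1G _ _] := chief_factorP _ _ _ ch1.
have nK1 := subsetP (normal_norm nK1G).
rewrite morphX ?nK1 //; have [] := prime_norm_cent pr1.
rewrite card_quotient ?(ordK _ _ ch1) //; last first.
  by rewrite (subset_trans (normal_sub nL1G)) ?normal_norm.
by move=> cX _; apply: cX; rewrite (subsetP nL1) ?mem_quotient.
Qed.

Lemma special_chief_factor_order_p b (Q : {group gT}) :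
    p.-group Q -> b || quaternion_like_free Q ->
    (forall x, x \in Q -> special_elt b p x -> partial_Pi_elt p G x) ->
  forall K L, chief_factor G K L -> L \subset Q -> #|L : K| = p.
Proof.
move=> pQ freeQ piQ K L; move: {2}_.+1 (ltnSn #|L|) => n.
elim: n K L => // n IHn K L leLn chKL sLQ.
have [nKG nLG ltKL minL] := chief_factorP _ _ _ chKL.
have [sKG nKG'] := andP nKG; have [sLG nLG'] := andP nLG.
have [sKL not_sLK] := andP ltKL; have pL := pgroupS sLQ pQ.
have nKL : L \subset 'N(K) := subset_trans sLG nKG'.
(* If M < L is normal in G and M is not contained in K, then L / K is           *)
(* G-isomorphic to M / (M :&: K), which is covered by induction.                *)
have [/existsP[M /and4P[nMG sML ltML not_sMK]] | noM] :=
    boolP [exists M : {group gT},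
      [&& M <| G, M \subset L, #|M| < #|L| & ~~ (M \subset K)]].
  have [chM ->] := chief_factor_setI chKL nMG sML not_sMK.
  by apply: IHn chM _; rewrite ?(leq_trans ltML) // (subset_trans sML).
have {}minL M : M <| G -> M \proper L -> M \subset K.
  move=> nMG ltML; apply: contraR noM => not_sMK; apply/existsP; exists M.
  by rewrite nMG proper_sub ?proper_card.
have maxL M : M <| G -> M \subset L -> ~~ (M \subset K) -> M :=: L.
  move=> nMG sML; apply: contraNeq => neML; apply: minL => //.
  by rewrite properEneq neML.
have ordK K1 L1 : chief_factor G K1 L1 -> L1 \subset K -> #|L1 : K1| = p.
  move=> ch1 sL1; apply: IHn ch1 _; last exact: subset_trans (subset_trans sL1 sKL) sLQ.
  exact: leq_trans (leq_ltn_trans (subset_leq_card sL1) (proper_card ltKL)) leLn.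
pose D := <<[set a in 'C_G(K) | p^'.-elt a]>>%G.
have sDC : D \subset 'C_G(K).
  by rewrite gen_subG; apply/subsetP=> a; rewrite inE => /andP[].
have nDG : G \subset 'N(D).
  rewrite norms_gen //; apply/subsetP=> g Gg; rewrite inE.
  apply/subsetP=> _ /imsetP[a + ->]; rewrite !inE => /andP[/andP[Ga Ca] p'a].
  rewrite groupJ // memJ_norm ?Ca /=; last by rewrite (subsetP (norms_cent nKG')).
  by rewrite /p_elt orderJ.
have sRL : [~: L, D] \subset L.
  by rewrite commg_subl (subset_trans sDC) // subIset // nLG'.
have nRG : [~: L, D] <| G by rewrite /normal (subset_trans sRL) ?normsR.
have [sRK | not_sRK] := boolP ([~: L, D] \subset K).
  apply: chief_factor_order_p chKL pL ordK _ => a Ca p'a x Lx.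
  apply: (subsetP sRK); apply: mem_commg => //.
  by apply: mem_gen; rewrite inE Ca.
have defR : [~: L, D] = L := maxL [~: L, D]%G nRG sRL not_sRK.
have cDK : D \subset 'C(K) := subset_trans sDC (subsetIr _ _).
have nKsL : K <| L by rewrite /normal sKL.
have ntL : L :!=: 1 by apply: contraNneq not_sLK => ->; apply: sub1G.
have sPhiK : 'Phi(L) \subset K.
  by apply: minL; [apply: char_normal_trans (Phi_char L) nLG | apply: Phi_proper].
have [S sylS] := Sylow_exists p G; have [sSG pS _] := and3P sylS.
have sLS : L \subset S by apply: normal_sub_max_pgroup (Hall_max sylS) pL nLG.
have expK x : x \in L -> x ^+ p \in K.
  move=> Lx; apply: (subsetP sPhiK); rewrite (Phi_joing pL) mem_gen // inE.
  by rewrite orbC (Mho_p_elt 1) ?expn1 // (mem_p_elt pL).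
have piK x : x \in L -> special_elt b p x -> p.-nat #|G : 'N_G(<[x]> <*> K)|.
  move=> Lx sx; apply: (partial_Pi_elt_norm _ nKG nLG Lx minL).
  by apply: piQ => //; apply: (subsetP sLQ).
have ordL x : x \in L -> x \notin K -> G \subset 'N(<[x]> <*> K) -> #|L : K| = p.
  by move=> Lx notKx; apply: chief_factor_cyclic chKL Lx notKx (expK x Lx).
have stab (H : {group gT}) x :
    H \subset G -> x \in L -> {in H, forall h, [~ x, h] \in K} ->
  H \subset 'N(<[x]> <*> K).
  move=> sHG Lx cH; apply/subsetP=> h Hh; rewrite inE.
  rewrite -genJ conjUg gen_subG subUset.
  have /normP -> : h \in 'N(K) := (subsetP nKG' h (subsetP sHG h Hh)).
  rewrite joing_subr andbT -cycleJ cycle_subG -(mulKVg x (x ^ h)) -commgEl.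
  by rewrite groupM // mem_gen // inE ?cycle_id // cH ?orbT.
have freeL : b || quaternion_like_free L.
  by case/orP: freeQ => [-> | /(quaternion_like_freeS sLQ) ->]; rewrite ?orbT.
have [spL | [p2 [x [Lx notKx ox]]]] :=
    perfect_action_special pr_p pL nKsL sPhiK cDK defR not_sLK freeL.
  (* Every nontrivial element of L is special, so x can be chosen fixed by S modulo K. *)
  have [x [Lx notKx cSx]] := chief_factor_central chKL pL sylS.
  apply: (ordL x) => //.
  have ntx : x != 1 by apply: contraNneq notKx => ->.
  have pT := piK x Lx (spL x Lx ntx).
  rewrite -(pnat_index_mul pT _ sylS) ?subsetIl // mul_subG ?subsetIr //.
  exact: stab.
have sx : special_elt b p x by rewrite p2; apply: special_elt_order_p.
have pT := piK x Lx sx; pose T := 'N_G(<[x]> <*> K).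
apply: (ordL x) => //; apply: stab => // g Gg.
have nKS : S \subset 'N(K) := subset_trans sSG nKG'.
have nLS : S \subset 'N(L) := subset_trans sSG nLG'.
(* The involution x need not be fixed by S modulo K. But J is proper in L because [S / K] is
   nilpotent, and T fixes x modulo K because <x> K / K has order 2. As [T * S = G], the normal
   subgroup [<x>, G] lies in J, so it is proper in L and hence inside K. *)
pose J := ([~: L, S] <*> K)%G.
have ltJL : J \proper L.
  rewrite properEneq join_subG sKL commg_subl nLS !andbT; apply: contraNneq not_sLK.
  move=> defJ; rewrite -quotient_sub1 // subG1; apply: contraT => ntLK.
  have : [~: L / K, S / K] \proper L / K.
    apply: nil_comm_properl (quotient_nil K (pgroup_nil pS)) _ ntLK _.
      exact: quotientS.
    by rewrite subsetI subxx quotient_norms.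
  have sRL' : [~: L, S] \subset L by rewrite commg_subl.
  rewrite -quotientR // -(quotientYidr (subset_trans sRL' nKL)).
  by rewrite -[in X in _ \proper X]defJ properxx.
have cTx t : t \in T -> [~ x, t] \in K.
  case/setIP=> Gt /normP nxKt.
  have : x ^ t \in <[x]> <*> K by rewrite -nxKt memJ_conjg mem_gen // inE cycle_id.
  have nKx : <[x]> \subset 'N(K) by rewrite cycle_subG (subsetP nKL).
  rewrite norm_joinEl // => /mulsgP[u k + Kk].
  rewrite /= (cycle2g ox) => /set2P[] -> xt.
    case/negP: notKx; rewrite -(memJ_norm x (subsetP nKG' t Gt)) xt mul1g.
    exact: Kk.
  by rewrite commgEl xt mulKg.
have cJx h : h \in G -> [~ x, h] \in J.
  rewrite -(pnat_index_mul pT (subsetIl _ _) sylS) => /mulsgP[t s Tt Ss ->].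
  rewrite commgMJ groupM //.
    by rewrite mem_gen // inE mem_commg.
  rewrite mem_gen // inE orbC memJ_norm ?cTx //.
  by rewrite (subsetP nKS).
have sNJ : [~: <[x]>, G] \subset J.
  rewrite gen_subG; apply/subsetP=> _ /imset2P[u h xu Gh ->].
  by move: xu; rewrite (cycle2g ox) => /set2P[] ->; rewrite ?comm1g ?group1 ?cJx.
have sNL := sub_proper_trans sNJ ltJL.
have nNG : [~: <[x]>, G] <| G.
  by rewrite /normal commg_normr (subset_trans (proper_sub sNL)).
apply: (subsetP (minL [~: <[x]>, G]%G nNG sNL)).
by rewrite mem_commg ?cycle_id.
Qed.
End OrderP.

(** * Fusion and transfer *)

Section Fusion.

Variables (gT : finGroupType) (p : nat) (X : {group gT}).
Implicit Types C N P S T U : {group gT}.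

Lemma pnat_index_p'elts C N :
  C \subset N -> {in N, forall a, p^'.-elt a -> a \in C} -> p.-nat #|N : C|.
Proof.
move=> sCN p'C; apply/pnatP=> // q pr_q q_dv; apply: contraLR q_dv => p'q.
have [R sylR] := Sylow_exists q N; have [sRN qR q'R] := and3P sylR.
have sRC : R \subset C.
  apply/subsetP=> a Ra; apply: p'C; first exact: (subsetP sRN).
  exact: pi_pnat (mem_p_elt qR Ra) _.
rewrite -p'natE //; apply: pnat_dvd q'R; exact: indexgS.
Qed.

(** Frobenius's condition: ['N_X(U) / 'C_X(U)] is a p-group for every p-subgroup U of X. *)
Hypothesis p'cent : forall U a,
  p.-group U -> U \subset X -> a \in 'N_X(U) -> p^'.-elt a -> U \subset 'C[a].

Lemma norm_Sylow_cent U S :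
  p.-group U -> U \subset X -> p.-Sylow('N_X(U)) S -> S * 'C_X(U) = 'N_X(U).
Proof.
move=> pU sUX /and3P[sSN _ p'S].
have sCN : 'C_X(U) \subset 'N_X(U) by rewrite setIS ?cent_sub.
apply: coprime_index_mulG => //; rewrite coprime_sym.
apply: pnat_coprime p'S; apply: pnat_index_p'elts => // a Na p'a.
have [Xa _] := setIP Na.
by rewrite inE Xa -sub_cent1 p'cent.
Qed.

(** Induction from large intersections. For D = S :&: T, the groups N_S(D) and N_T(D) properly
    contain D and lie in Sylow subgroups of N_X(D) conjugate by some c in C_X(D). If U is a Sylow
    subgroup of X over the first of these, then S meets U, and U^c meets T, in more than D. *)
Lemma Sylow_trans_cent S T :
  p.-Sylow(X) S -> p.-Sylow(X) T ->
  exists2 c, c \in 'C_X(S :&: T) & T :=: S :^ c.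
Proof.
move: {2}_.+1 (ltnSn (#|X| - #|S :&: T|)) => n.
elim: n S T => // n IHn S T leDn sylS sylT.
have [sSX pS _] := and3P sylS; have [sTX pT _] := and3P sylT.
have cardST : #|S| = #|T| by rewrite (card_Hall sylS) (card_Hall sylT).
have [D defD] : exists D : {group gT}, D :=: S :&: T by exists (S :&: T)%G.
rewrite -defD in leDn *; have [sDS sDT] : D \subset S /\ D \subset T.
  by rewrite defD subsetIl subsetIr.
have sDX := subset_trans sDS sSX; have pD := pgroupS sDS pS.
have [eqDS | neDS] := eqVneq (D : {set gT}) S.
  exists 1; first exact: group1.
  by rewrite conjsg1; apply/esym/eqP; rewrite eqEcard cardST leqnn andbT -eqDS.
have neDT : D :!=: T.
  by apply: contraNneq neDS => eqDT; rewrite eqEcard sDS /= cardST eqDT.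
have IH S1 T1 : p.-Sylow(X) S1 -> p.-Sylow(X) T1 -> D \proper S1 :&: T1 ->
    exists2 c, c \in 'C_X(D) & T1 :=: S1 :^ c.
  move=> sylS1 sylT1 ltD; have [||| c Cc ->] := IHn S1 T1 => //.
    apply: leq_trans (_ : _ < #|X| - #|D|) leDn; apply: ltn_sub2l.
      apply: leq_trans (proper_card ltD) (subset_leq_card _).
      by rewrite subIset // (pHall_sub sylS1).
    exact: proper_card.
  by exists c => //; apply: subsetP Cc; rewrite setIS ?centS ?proper_sub.
have ltND (R : {group gT}) : p.-group R -> D \subset R -> D :!=: R -> D \proper 'N_R(D).
  move=> pR sDR neDR; apply: nilpotent_proper_norm (pgroup_nil pR) _.
  by rewrite properEneq neDR.
have NP (R : {group gT}) : R \subset X -> p.-group R -> exists2 Q : {group gT},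
    p.-Sylow('N_X(D)) Q & 'N_R(D) \subset Q.
  move=> sRX pR; have pN : p.-group 'N_R(D) := pgroupS (subsetIl _ _) pR.
  have [Q sylQ sNQ] := Sylow_superset (setSI _ sRX : 'N_R(D) \subset 'N_X(D)) pN.
  by exists Q.
have [Q1 sylQ1 sSQ1] := NP S sSX pS; have [Q2 sylQ2 sTQ2] := NP T sTX pT.
have [m Nm defQ2] := Sylow_trans sylQ1 sylQ2.
have [c Cc defQ2c] : exists2 c, c \in 'C_X(D) & Q2 :=: Q1 :^ c.
  move: Nm; rewrite /= -(norm_Sylow_cent pD sDX sylQ1) => /mulsgP[r c Qr Cc Dm].
  by exists c => //; rewrite defQ2 Dm conjsgM (conjGid Qr).
have [Xc cDc] := setIP Cc.
have [sQ1N pQ1 _] := and3P sylQ1.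
have [U sylU sQ1U] := Sylow_superset (subset_trans sQ1N (subsetIl _ _)) pQ1.
have sylUc : p.-Sylow(X) (U :^ c) by rewrite pHallJ.
have [||| b Cb defU] := IH S U => //.
  apply: proper_sub_trans (ltND S pS sDS neDS) _.
  by rewrite subsetI subsetIl (subset_trans sSQ1).
have [||| d Cd defT] := IH (U :^ c)%G T => //.
  apply: proper_sub_trans (ltND T pT sDT neDT) _.
  by rewrite subsetI subsetIl andbT (subset_trans sTQ2) // defQ2c conjSg.
exists (b * c * d); first by rewrite !groupM.
by rewrite defT /= defU !conjsgM.
Qed.

(** Some c centralising P^g :&: P, which contains x^g, takes P^g back to P. Then g c lies in N_X(P)
    = P C_X(P), and its P-part acts on x as g does. *)
Lemma Sylow_control_fusion P x g :
  p.-Sylow(X) P -> x \in P -> g \in X -> x ^ g \in P ->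
  exists2 u, u \in P & x ^ g = x ^ u.
Proof.
move=> sylP Px Xg Pxg; have [sPX pP _] := and3P sylP.
have sylPg : p.-Sylow(X) (P :^ g) by rewrite pHallJ.
have [c /setIP[Xc cc] defP] := Sylow_trans_cent sylPg sylP.
have xgc : (x ^ g) ^ c = x ^ g.
  have PgP : x ^ g \in P :^ g :&: P by apply/setIP; rewrite memJ_conjg.
  exact/conjg_fixP/commgP/commute_sym/(centP cc).
have : g * c \in 'N_X(P).
  by rewrite inE groupM //=; apply/normP; rewrite conjsgM -defP.
have sylNP : p.-Sylow('N_X(P)) P.
  by apply: pHall_subl (subsetIl _ _) sylP; rewrite subsetI sPX normG.
rewrite -(norm_Sylow_cent pP sPX sylNP).
case/mulsgP=> u z Pu /setIP[Xz cz] Dgc.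
exists u => //; rewrite -xgc -conjgM Dgc conjgM.
by apply/conjg_fixP/commgP/commute_sym/(centP cz); rewrite groupJ.
Qed.

End Fusion.

(* When P controls its own fusion, the transfer into P / P' maps x in P to      *)
(* x ^+ #|X : P|, and it vanishes on the derived subgroup.                      *)
Lemma perfect_control_fusion (gT : finGroupType) (p : nat) (X P : {group gT}) :
    p.-Sylow(X) P -> X^`(1) = X ->
    (forall x g, x \in P -> g \in X -> x ^ g \in P ->
       exists2 u, u \in P & x ^ g = x ^ u) ->
  P :=: 1.
Proof.
move=> sylP perfX fusP; have [sPX pP p'P] := and3P sylP.
have nPP' : P \subset 'N(P^`(1)) := der_norm 1 P.
pose alpha := restrm_morphism nPP' (coset_morphism P^`(1)).
have alphaE : alpha @* P = P / P^`(1) by rewrite morphim_restrm setIid.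
have abP : abelian (alpha @* P) by rewrite alphaE; apply: der_abelian.
pose tau := transfer_morphism X abP.
have tau0 g : g \in X -> transfer X abP g = 0%R.
  rewrite -[in _ \in _]perfX => X'g.
  suffices sker : X^`(1) \subset 'ker tau by exact: mker (subsetP sker g X'g).
  rewrite gen_subG; apply/subsetP=> _ /imset2P[u v Xu Xv ->].
  apply/kerP; rewrite ?groupR // morphR //; apply/eqP/commgP.
  exact: FinRing.zmod_mulgC.
suffices sPP' : P \subset P^`(1).
  apply: contraTeq sPP' => ntP; rewrite proper_subn //.
  exact: (sol_der1_proper (pgroup_sol pP) (subxx P) ntP).
apply/subsetP=> g Pg; have Xg := subsetP sPX g Pg.
have trX := transversalP (rcosets_cycle_partition sPX Xg).
set Y := transversal _ _ in trX; have sYX := transversal_sub trX.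
pose n x := #|<[g]> : P :* x|.
have alphag : alpha g \in alpha @* P by rewrite mem_morphim.
have termE x : x \in Y ->
    restrm (transfer_morph_subproof alpha) (FiniteModule.fmod abP \o alpha)
      ((g ^+ n x) ^ x^-1) = (FiniteModule.fmod abP (alpha g) *+ n x)%R.
  (* Each transfer factor is a conjugate of [g ^+ n x] lying in P, hence a P-conjugate, with the
     same image in P / P'. *)
  move=> Yx; have Xx := subsetP sYX x Yx.
  have Pgn : (g ^+ n x) ^ x^-1 \in P.
    have := mulg_exp_card_rcosets P g x; rewrite -/(n x) mem_rcoset.
    by rewrite /conjg invgK mulgA.
  have [u Pu ->] := fusP _ _ (groupX (n x) Pg) (groupVr Xx) Pgn.
  rewrite -[LHS]/(FiniteModule.fmod abP (alpha ((g ^+ n x) ^ u))).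
  rewrite morphJ ?groupX // morphX // -FiniteModule.fmodX //; congr FiniteModule.fmod.
  apply/conjg_fixP/commgP/(centsP abP); rewrite ?groupX //.
  exact: mem_morphim.
(* The exponents [n x] add up to |X : P|, a p'-number, so the p-element [alpha g] is trivial. *)
have := tau0 g Xg; rewrite (transfer_cycle_expansion sPX abP Xg trX).
rewrite (eq_bigr _ termE) GRing.sumrMnr (sum_index_rcosets_cycle sPX Xg trX).
move/(congr1 FiniteModule.fmval); rewrite FiniteModule.fmvalZ FiniteModule.fmodK //.
rewrite FiniteModule.fmval0 => /eqP; rewrite -order_dvdn => dv_g.
have pg : p.-elt (alpha g) by rewrite morph_p_elt ?(mem_p_elt pP).
have := dvdn_gcd #[alpha g] #[alpha g] #|X : P|.
rewrite (eqnP (pnat_coprime pg p'P)) dvdnn dv_g dvdn1 order_eq1 => /eqP ag1.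
apply: coset_idr ag1.
exact: (subsetP nPP').
Qed.

(** * The case O_p'(E) = 1 *)

Section TrivialP'core.

Variables (gT : finGroupType) (p : nat) (b : bool) (G E P : {group gT}).
Hypotheses (pr_p : prime p) (nEG : E <| G) (sylP : p.-Sylow(E) P).
Hypothesis freeP : b || quaternion_like_free P.
Hypothesis piP : forall x, x \in P -> special_elt b p x -> partial_Pi_elt p G x.
Hypothesis p'core1 : 'O_p^'(E) = 1.

Let Q := 'O_p(E)%G.

Let pQ : p.-group Q. Proof. exact: pcore_pgroup. Qed.
Let sQP : Q \subset P. Proof. exact: pcore_sub_Hall sylP. Qed.
Let nQG : Q <| G. Proof. exact: char_normal_trans (pcore_char _ _) nEG. Qed.
Let sPE : P \subset E. Proof. exact: pHall_sub sylP. Qed.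
Let pP : p.-group P. Proof. exact: pHall_pgroup sylP. Qed.

Lemma cent_pcore_sub : 'C_E(Q) \subset Q.
Proof.
apply: contraT => not_sCQ.
pose gP (N : {group gT}) := [&& G \subset 'N(N), N \subset 'C_E(Q) & ~~ (N \subset Q)].
have [X /mingroupP[/and3P[nXG' sXC not_sXQ] minX]] : {X : {group gT} | [min X | gP X]}.
  apply: ex_mingroup; exists 'C_E(Q)%G; rewrite /gP subxx not_sCQ !andbT.
  by rewrite normsI ?norms_cent ?normal_norm.
have [sXE cXQ] := subsetIP sXC.
have nXG : X <| G by rewrite /normal nXG' (subset_trans sXE) ?normal_sub.
have nXE : X <| E := normalS sXE (normal_sub nEG) nXG.
have {}minX (N : {group gT}) : N <| G -> N \proper X -> N \subset Q.
  move=> nNG /andP[sNX not_sXN]; apply: contraR not_sXN => not_sNQ.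
  rewrite (minX N) // /gP (normal_norm nNG) not_sNQ andbT.
  exact: subset_trans sNX sXC.
pose P1 := (P :&: X)%G.
have sylP1 : p.-Sylow(X) P1 := Hall_setI_normal nXE sylP.
(* Apply [partial_Pi_elt_norm] with Q and X for K and L: the p-group <x> Q lies in O_p(G), and
   O_p(G) :&: E = Q. *)
have specQ x : x \in P1 -> special_elt b p x -> x \in Q.
  case/setIP=> Px Xx sx.
  have pT := partial_Pi_elt_norm (piP Px sx) nQG nXG Xx minX.
  have sxQP : <[x]> <*> Q \subset P by rewrite join_subG cycle_subG Px.
  have sxQE := subset_trans sxQP sPE.
  have := pnat_index_pcore (subset_trans sxQE (normal_sub nEG)) (pgroupS sxQP pP) pT.
  rewrite join_subG cycle_subG => /andP[Ox _].
  by rewrite /= -(pcore_setI_normal p nEG) inE Ox (subsetP sPE).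
have subP1 (U : {group gT}) : U \subset X -> p.-group U ->
    exists2 x, x \in X & U :^ x \subset P1.
  exact: Sylow_Jsub sylP1.
have p'cent (U : {group gT}) a :
    p.-group U -> U \subset X -> a \in 'N_X(U) -> p^'.-elt a -> U \subset 'C[a].
  move=> pU sUX /setIP[Xa nUa] p'a; have [x Xx sUxP] := subP1 U sUX pU.
  apply: (@special_centralised _ b _ _ _ pr_p pU nUa p'a) => [|u Uu su].
    case/orP: freeP => [-> // | freeP'].
    rewrite (_ : U = ((U :^ x) :^ x^-1)%G); last first.
      by apply: val_inj; rewrite /= conjsgK.
    have sUP := subset_trans sUxP (subsetIl _ _).
    by rewrite (quaternion_like_freeJ _ (quaternion_like_freeS sUP freeP')) orbT.
  have Qu : u \in Q.
    rewrite -(memJ_norm u (_ : x \in 'N(Q))).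
      by apply: specQ; rewrite ?special_eltJ // (subsetP sUxP) // memJ_conjg.
    by rewrite (subsetP (normal_norm nQG)) // (subsetP (normal_sub nXG)).
  exact/commute_sym/(centP (subsetP cXQ a Xa)).
have [perfX | not_perfX] := eqVneq (X^`(1)) X.
  have P11 : P1 :=: 1.
    apply: (perfect_control_fusion sylP1 perfX) => x g.
    exact: (Sylow_control_fusion p'cent sylP1).
  have p'X : p^'.-group X.
    have := card_Hall sylP1; rewrite P11 cards1 => /esym/eqP.
    by rewrite p_part_eq1 /pgroup p'natEpi.
  by case/negP: not_sXQ; rewrite (subset_trans (pcore_max p'X nXE)) // p'core1 sub1G.
(* As X centralises Q, it is nilpotent; O_p'(X) = 1 then makes it a p-group inside Q. *)
have sX'Q : X^`(1) \subset Q.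
  apply: (minX X^`(1)%G); first exact: char_normal_trans (der_char 1 X) nXG.
  by rewrite properEneq not_perfX der_sub.
have nilX : nilpotent X.
  rewrite -quotient_center_nil abelian_nil // sub_der1_abelian //.
  by rewrite subsetI der_sub centsC; apply: subset_trans cXQ (centS sX'Q).
case/negP: not_sXQ; have := nilpotent_pcoreC p nilX.
have -> : 'O_p^'(X) = 1.
  apply/trivgP; rewrite -p'core1 pcore_max ?pcore_pgroup //.
  exact: char_normal_trans (pcore_char _ _) nXE.
rewrite dprodg1 => <-; rewrite pcore_max ?pcore_pgroup //.
exact: char_normal_trans (pcore_char _ _) nXE.
Qed.

Lemma chief_factor_pcore (K L : {group gT}) :
  chief_factor G K L -> L \subset Q -> #|L : K| = p.
Proof.
move=> chKL sLQ; have freeQ : b || quaternion_like_free Q.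
  by case/orP: freeP => [-> | /(quaternion_like_freeS sQP) ->]; rewrite ?orbT.
apply: (special_chief_factor_order_p pr_p pQ freeQ _ chKL sLQ) => x Qx.
exact: piP (subsetP sQP x Qx).
Qed.

Lemma Sylow_sub_pcore : P \subset Q.
Proof.
suffices sE'Q : E^`(1) \subset Q.
  apply: pcore_max pP _; apply: sub_der1_normal sPE.
  exact: subset_trans sE'Q sQP.
have pE' : p.-group E^`(1).
  rewrite /pgroup -indexg1; apply: (@pnat_index_p'elts _ p 1%G) => [|a E'a p'a].
    exact: sub1G.
  have Ea : a \in E := subsetP (der_sub 1 E) a E'a.
  have Ga : a \in G := subsetP (normal_sub nEG) a Ea.
  have Qa : a \in Q.
    apply: (subsetP cent_pcore_sub); rewrite inE Ea /= -sub_cent1.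
    apply: (chief_factors_cent nQG pQ p'a Ga) => K L chKL sLQ.
    have [nKG nLG _ _] := chief_factorP _ _ _ chKL.
    have nKL := subset_trans (normal_sub nLG) (normal_norm nKG).
    have nKa := subsetP (normal_norm nKG) a Ga.
    apply/mem_astabQP => //; apply: (subsetP _ a E'a).
    have pr_LK : prime #|L / K| by rewrite card_quotient // (chief_factor_pcore chKL).
    rewrite gen_subG; apply/subsetP=> _ /imset2P[g h Eg Eh ->].
    have nLKE x : x \in E -> coset K x \in 'N(L / K).
      move=> Ex; have Gx := subsetP (normal_sub nEG) x Ex.
      by rewrite (subsetP (quotient_norms K (normal_norm nLG))) ?mem_quotient.
    have nKE x : x \in E -> x \in 'N(K).
      by move=> Ex; rewrite (subsetP (normal_norm nKG)) // (subsetP (normal_sub nEG)).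
    rewrite /= astabQ; apply: mem_morphpre; first by rewrite groupR ?nKE.
    by rewrite morphR ?nKE //; have [_] := prime_norm_cent pr_LK; apply; apply: nLKE.
  apply/set1P/eqP; rewrite -order_eq1 -dvdn1.
  by rewrite -(eqnP (pnat_coprime (mem_p_elt pQ Qa) p'a)) dvdn_gcd dvdnn.
by apply: pcore_max pE' _; apply: der_normal.
Qed.

(** Since P = Q, [P :&: L] is normal in G and Sylow in L. It is not inside K, so it carries [L / K]
    down below Q. *)
Lemma chief_factor_p'core1 (K L : {group gT}) :
  chief_factor G K L -> L \subset E -> p %| #|L : K| -> #|L : K| = p.
Proof.
move=> chKL sLE p_dv; have [nKG nLG ltKL _] := chief_factorP _ _ _ chKL.
have nLE := normalS sLE (normal_sub nEG) nLG.
have nML : P :&: L <| G.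
  suffices -> : P :&: L = Q :&: L by apply: normalI.
  by congr (_ :&: _); apply/eqP; rewrite eqEsubset Sylow_sub_pcore.
have [_ _ p'M] := and3P (Hall_setI_normal nLE sylP).
have [sMK | not_sMK] := boolP (P :&: L \subset K).
  have := pnat_dvd (indexgS L sMK) p'M; rewrite p'natE //.
  by rewrite p_dv.
have [chM ->] := chief_factor_setI chKL (nML : (P :&: L)%G <| G) (subsetIr _ _) not_sMK.
by apply: chief_factor_pcore chM _; rewrite subIset // Sylow_sub_pcore.
Qed.

End TrivialP'core.

(** * Reduction modulo O_p'(E) *)

(** [N / M] is the witness: if it contained [coset M x], the p-element [coset N x] would lie in the
    p'-group [M / N], and x in N. *)
Lemma partial_Pi_elt_quotient (gT : finGroupType) (p : nat)
    (G M : {group gT}) x :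
    M <| G -> p^'.-group M -> p.-elt x -> x \in G ->
  partial_Pi_elt p G x -> partial_Pi_elt p (G / M) (coset M x).
Proof.
move=> nMG p'M p_x Gx [N nNG [notNx pN]]; exists (N / M)%G.
  exact: quotient_normal.
have [sMG nMG'] := andP nMG; have [sNG nNG'] := andP nNG.
have nMx := subsetP nMG' x Gx; have nMN := subset_trans sNG nMG'.
have nNx := subsetP nNG' x Gx; have nNM := subset_trans sMG nNG'.
split.
  apply: contra notNx => Nx.
  have MNx : x \in M * N by rewrite -quotientK // mem_morphpre.
  have MNxN : coset N x \in M / N.
    by case/mulsgP: MNx => m n Mm Nn ->; rewrite coset_kerr // mem_quotient.
  apply: coset_idr => //; apply/eqP; rewrite -order_eq1 -dvdn1.
  have p_xN : p.-elt (coset N x) by rewrite morph_p_elt.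
  rewrite -(eqnP (pnat_coprime p_xN (mem_p_elt (quotient_pgroup N p'M) MNxN))).
  by rewrite dvdn_gcd dvdnn.
apply: pnat_dvd pN.
have sN1 : 'N_G(<[x]> <*> N) / M \subset 'N_(G / M)(<[coset M x]> <*> (N / M)).
  rewrite subsetI quotientS ?subsetIl //= -quotient_cycle //.
  rewrite -quotientY ?cycle_subG // quotient_norms //.
  exact: subsetIr.
apply: dvdn_trans (indexgS _ sN1) _; apply: index_morphim.
by rewrite subIset ?nMG'.
Qed.

Lemma chief_factor_quotient (gT : finGroupType) (G K L M : {group gT}) :
    M <| G -> M :&: L \subset K -> chief_factor G K L ->
  chief_factor (G / M) (K / M) (L / M) /\ #|L / M : K / M| = #|L : K|.
Proof.
move=> nMG sMLK /chief_factorP[nKG nLG /andP[sKL not_sLK] minL].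
have [sMG nMG'] := andP nMG; have nML := subset_trans (normal_sub nLG) nMG'.
have index_eq : #|L / M : K / M| = #|L : K|.
  by apply: index_quotient_eq => //; rewrite setIC.
split=> //; apply/chief_factorP; split; rewrite ?quotient_normal //.
  rewrite properE quotientS //=; apply: contra not_sLK => sLK.
  by rewrite -indexg_eq1 -index_eq indexg_eq1.
move=> H nHG sKH sHL.
pose H1 := (L :&: coset M @*^-1 H)%G.
have defH : H1 / M = H by rewrite quotient_setIpre; apply/setIidPr.
have nH1G : H1 <| G.
  rewrite /normal subIset ?(normal_sub nLG) //=.
  apply: normsI; first exact: normal_norm.
  rewrite -(quotientGK nMG).
  exact: subset_trans (morphpreS _ (normal_norm nHG)) (morphpre_norm _ _).
have [||| defH1 | defH1] := minL H1 => //.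
- by rewrite subsetI sKL -sub_quotient_pre // (subset_trans sKL nML).
- exact: subsetIl.
- by left; rewrite -defH defH1.
by right; rewrite -defH defH1.
Qed.

Lemma chief_factor_below_order_p (gT : finGroupType) (p : nat) b
    (G E P K L : {group gT}) :
    prime p -> E <| G -> p.-Sylow(E) P -> b || quaternion_like_free P ->
    (forall x, x \in P -> special_elt b p x -> partial_Pi_elt p G x) ->
  chief_factor G K L -> L \subset E -> p %| #|L : K| -> #|L : K| = p.
Proof.
move=> pr_p nEG sylP freeP piP chKL sLE p_dv.
have [_ nLG _ _] := chief_factorP _ _ _ chKL.
have [sEG nEG'] := andP nEG; have [sPE pP _] := and3P sylP.
pose M := 'O_p^'(E)%G; have p'M : p^'.-group M := pcore_pgroup _ _.
have nMG : M <| G := char_normal_trans (pcore_char _ _) nEG.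
have sMLK : M :&: L \subset K.
  (* Otherwise [L / K] would be isomorphic to a section of the p'-group M. *)
  apply: contraLR p_dv => not_sMK.
  have nMLG : (M :&: L)%G <| G by apply: normalI.
  have sMLK : ~~ ((M :&: L)%G \subset K) by [].
  have [_ ->] := chief_factor_setI chKL nMLG (subsetIr _ _) sMLK.
  rewrite -p'natE //; apply: pnat_dvd (dvdn_indexg _ _) _.
  exact: pgroupS (subsetIl _ _) p'M.
have [chM eqLK] := chief_factor_quotient nMG sMLK chKL.
rewrite -eqLK; rewrite -eqLK in p_dv.
have nPM : P \subset 'N(M) := subset_trans (subset_trans sPE sEG) (normal_norm nMG).
(* P embeds in [G / M], which preserves element orders and quaternion-like-freeness. *)
pose f := restrm_morphism nPM (coset_morphism M).
have injf : 'injm f.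
  by rewrite ker_restrm ker_coset coprime_TIg ?(pnat_coprime pP).
have fPE : f @* P = P / M by rewrite morphim_restrm setIid.
apply: (@chief_factor_p'core1 _ p b (G / M)%G (E / M)%G (P / M)%G) chM _ p_dv => //.
- exact: quotient_normal.
- exact: quotient_pHall.
- case/orP: freeP => [-> // | /(injm_quaternion_like_free injf (subxx P))].
  by rewrite (_ : (f @* P)%G = (P / M)%G) => [->|]; [rewrite orbT | apply: val_inj].
- move=> _ /morphimP[x Nx Px ->] sx; apply: partial_Pi_elt_quotient => //.
  + exact: mem_p_elt pP Px.
  + by rewrite (subsetP sEG) // (subsetP sPE).
  have ofx : #[coset M x] = #[x] := order_injm injf Px.
  by apply: piP => //; move: sx; rewrite /special_elt /= ofx.
- exact: trivg_pcore_quotient.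
exact: quotientS.
Qed.

(** At the first term L of the series containing x, the intersection with [L / K] is the whole
    p-group [<[x]> / K], so the index of its normaliser, which is |G : N_G(<x> K)|, is a power of
    p. *)
Lemma partial_Pi_cycle (gT : finGroupType) (p : nat) (G : {group gT}) x :
  p.-elt x -> x \in G -> x != 1 -> partial_Pi G <[x]>%G -> partial_Pi_elt p G x.
Proof.
move=> p_x Gx ntx [s [chs lastG piH]].
pose Pi i := (i < size s)%N && (x \in nth 1%G s i).
have exPi : exists i, Pi i.
  exists (size s).-1; rewrite /Pi nth_last lastG Gx andbT.
  case: s lastG {chs piH Pi} => [/= G1 | //].
  by move: ntx; rewrite -in_set1 [[set _]](congr1 val G1) Gx.
have [i /andP[lt_i Lx] min_i] := ex_minnP exPi.
pose K := nth 1%G (1%G :: s) i; pose L := nth 1%G s i.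
have [nKG nLG ltKL _] : [/\ K <| G, L <| G, K \proper L & True].
  by have [] := chief_factorP _ _ _ (pathP 1%G chs i lt_i).
have notKx : x \notin K.
  rewrite /K; case: (i) (min_i) lt_i => [_ _ | j minj lt_j] /=.
    by rewrite inE.
  apply/negP=> Kx; have := minj j; rewrite /Pi Kx (ltnW lt_j) => /(_ isT).
  by rewrite ltnn.
have nKx : <[x]> \subset 'N(K).
  by rewrite cycle_subG (subsetP (normal_norm nKG)).
have defI : (<[x]> / K) :&: (L / K) = <[x]> / K.
  by apply/setIidPl; rewrite quotientS // cycle_subG.
have := piH i lt_i; cbv zeta; rewrite -/K -/L [_ :&: _]defI => piK.
exists K => //; split=> //.
have nKxK : K <| <[x]> <*> K.
  by rewrite /normal joing_subr join_subG nKx normG.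
have <- : #|G / K : 'N_(G / K)(<[x]> / K)| = #|G : 'N_G(<[x]> <*> K)|.
  rewrite -(quotientYidr nKx) -quotient_subnormG //.
  apply: index_quotient_eq; rewrite ?subsetIl ?(normal_norm nKG) //.
  by rewrite setIS // (subset_trans _ (normG _)) ?joing_subr.
apply: sub_in_pnat piK => q _ q_pi.
exact: pnatPpi (quotient_pgroup K p_x : p.-group (<[x]> / K)) q_pi.
Qed.

(** * Supersolvability and the hypercentre *)

Lemma metacyclic_supersolvable (gT : finGroupType) (F N : {group gT}) :
  N <| F -> cyclic N -> cyclic (F / N) -> supersolvable F.
Proof.
move=> nNF cycN cycFN; apply: (@connect_trans _ _ N); apply: connect1 => /=.
  rewrite normal1 nNF sub1G /=.
  by rewrite -(isog_cyclic (quotient1_isog N)).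
by rewrite nNF normal_refl normal_sub.
Qed.

(** G / C_G(L/K) embeds in the cyclic group Aut(L/K), so the semidirect product is metacyclic. *)
Lemma prime_U_central (gT : finGroupType) (G K L : {group gT}) :
  K <| G -> L <| G -> prime #|L / K| -> U_central G L K.
Proof.
move=> nKG nLG prLK; have [defF isoL isoG] := factor_sdprodE nKG nLG.
set F1 := sdpair1 _ @* _ in defF isoL; set F2 := sdpair2 _ @* _ in defF isoG.
have [nF1F sF2F _ _ _] := sdprod_context defF.
have cycF1 : cyclic F1 by rewrite -(isog_cyclic isoL) prime_cyclic.
have cycF2 : cyclic (factor_sdprod G L K / F1).
  rewrite -(isog_cyclic (sdprod_isog defF)) -(isog_cyclic isoG).
  have sKC : K \subset 'C_G(L / K | 'Q).
    by rewrite subsetI normal_sub // astabQ sub_cosetpre.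
  have nCG : 'C_G(L / K | 'Q) <| G.
    by rewrite /normal subsetIl factor_norm.
  rewrite -(isog_cyclic (third_isog sKC nKG nCG)) /= astabQ quotient_setIpre.
  rewrite -ker_conj_aut.
  have nLKGK : G / K \subset 'N(L / K) by rewrite quotient_norms ?normal_norm.
  rewrite (isog_cyclic (first_isog_loc _ nLKGK)).
  exact: cyclicS (Aut_conj_aut _ _) (Aut_prime_cyclic prLK).
exact: metacyclic_supersolvable nF1F cycF1 cycF2.
Qed.

Lemma order_p_pU_hypercentral (gT : finGroupType) p (G N : {group gT}) :
    prime p -> N <| G ->
    (forall K L : {group gT}, chief_factor G K L -> L \subset N ->
       p %| #|L : K| -> #|L : K| = p) ->
  pU_hypercentral p G N.
Proof.
move=> pr_p nNG ordN; rewrite /pU_hypercentral nNG /=.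
apply/forallP=> K; apply/forallP=> L; apply/implyP=> /and3P[chKL sLN p_dv].
have [nKG nLG _ _] := chief_factorP _ _ _ chKL.
have nKL := subset_trans (normal_sub nLG) (normal_norm nKG).
by apply: prime_U_central; rewrite // card_quotient // ordN // -card_quotient.
Qed.

Theorem proposition1p6 (p : nat) (gT : finGroupType) (G E P : {group gT}) :
  prime p ->
  E <| G ->
  p.-Sylow(E) P ->
  (forall H : {group gT},
     H \subset P -> cyclic H ->
     prime #|H| \/ (#|H| = 4 /\ ~~ quaternion_free P) ->
     partial_Pi G H) ->
  E \subset pU_hypercentre p G.
Proof.
move=> pr_p nEG sylP piP; have [sPE pP _] := and3P sylP.
have hypE : pU_hypercentral p G E.
  apply: order_p_pU_hypercentral => // K L.
  apply: (chief_factor_below_order_p (b := ~~ quaternion_free P) pr_p nEG sylP).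
    case: (boolP (quaternion_free P)) => //= freeP; apply/forallP=> B.
    by apply/implyP=> sBP; apply: contraL freeP; apply: quaternion_like_section.
  move=> x Px sx; apply: partial_Pi_cycle.
  - exact: mem_p_elt pP Px.
  - by rewrite (subsetP (normal_sub nEG)) // (subsetP sPE).
  - apply: contraTneq sx => ->.
    by rewrite /special_elt order1 andbF orbF neq_ltn prime_gt1.
  apply: piP; rewrite ?cycle_subG ?cycle_cyclic //.
  case/orP: sx => [/eqP ox | /andP[nfree /eqP ox]].
    by left; rewrite -[#|_|]/#[x] ox.
  by right.
by rewrite /pU_hypercentre bigprodGE sub_gen // (bigcup_sup E).
Qed.
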